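(* Let $K$ be a field and let $d\geq2$ be an integer. The group $L_K(R_d)^\times$ is finitely generated if and only if $K$ is finite.
   Context: $L_K(R_d)$ (the Leavitt algebra $L_K(1,d)$) is the unital associative $K$-algebra generated by $a_1,\ldots,a_d,a_1^*,\ldots,a_d^*$ subject to $a_i^*a_j=\delta_{ij}1$ and $\sum_{i=1}^d a_ia_i^*=1$. For a ring $R$, $R^\times$ denotes its unit group. *)

(* Defs.v *)
From HB Require Import structures.
From mathcomp Require Import all_boot all_algebra.
From mathcomp Require Import boolp.

Set Implicit Arguments.
Unset Strict Implicit.
Unset Printing Implicit Defensive.

Import GRing.Theory.

Local Open Scope ring_scope.

(* The algebra L_K(1,d) is built from its presentation: terms in the generators
   a_i, a_i^* (i < d) with scalars from K, modulo the least congruence that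
   contains the axioms of unital associative K-algebras and the defining
   relations.  The scalar multiple c *: x is the product by the constant c. *)

Inductive lterm (K : Type) (d : nat) : Type :=
| LConst of K
| LGen of 'I_d
| LStar of 'I_d
| LAdd of lterm K d & lterm K d
| LOpp of lterm K d
| LMul of lterm K d & lterm K d.

Arguments LConst {K d}.
Arguments LGen {K d}.
Arguments LStar {K d}.

Inductive lcong (K : fieldType) (d : nat) : lterm K d -> lterm K d -> Prop :=
| lcong_refl t : lcong t t
| lcong_sym t u : lcong t u -> lcong u t
| lcong_trans t u v : lcong t u -> lcong u v -> lcong t v
| lcong_add t t' u u' :
    lcong t t' -> lcong u u' -> lcong (LAdd t u) (LAdd t' u')
| lcong_opp t t' : lcong t t' -> lcong (LOpp t) (LOpp t')
| lcong_mul t t' u u' :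
    lcong t t' -> lcong u u' -> lcong (LMul t u) (LMul t' u')
| lcong_addA t u v : lcong (LAdd t (LAdd u v)) (LAdd (LAdd t u) v)
| lcong_addC t u : lcong (LAdd t u) (LAdd u t)
| lcong_add0 t : lcong (LAdd (LConst 0) t) t
| lcong_addN t : lcong (LAdd (LOpp t) t) (LConst 0)
| lcong_mulA t u v : lcong (LMul t (LMul u v)) (LMul (LMul t u) v)
| lcong_mul1 t : lcong (LMul (LConst 1) t) t
| lcong_mulDl t u v :
    lcong (LMul (LAdd t u) v) (LAdd (LMul t v) (LMul u v))
| lcong_mulDr t u v :
    lcong (LMul t (LAdd u v)) (LAdd (LMul t u) (LMul t v))
| lcong_constD c e : lcong (LConst (c + e)) (LAdd (LConst c) (LConst e))
| lcong_constM c e : lcong (LConst (c * e)) (LMul (LConst c) (LConst e))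
| lcong_constC c t : lcong (LMul (LConst c) t) (LMul t (LConst c))
| lcong_star_gen i j :
    lcong (LMul (LStar i) (LGen j)) (LConst (i == j)%:R)
| lcong_gen_star :
    lcong (\big[@LAdd K d/LConst 0]_(i < d) LMul (LGen i) (LStar i)) (LConst 1).

HB.instance Definition _ (K : Type) (d : nat) := gen_eqMixin (lterm K d).
HB.instance Definition _ (K : Type) (d : nat) := gen_choiceMixin (lterm K d).

Section LeavittConstruction.
Context (K : fieldType) (d : nat).

Definition lcongb (t u : lterm K d) : bool := `[< lcong t u >].

Fact lcongb_refl : reflexive lcongb.
Proof. by move=> t; apply/asboolP/lcong_refl. Qed.

Fact lcongb_sym : symmetric lcongb.
Proof. by move=> t u; apply/asboolP/asboolP => /lcong_sym. Qed.

Fact lcongb_trans : transitive lcongb.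
Proof. by move=> u t v /asboolP h /asboolP k; apply/asboolP/(lcong_trans h k). Qed.

Canonical lcong_equiv := EquivRel lcongb lcongb_refl lcongb_sym lcongb_trans.

Definition leavitt : Type := {eq_quot lcong_equiv}%qT.

HB.instance Definition _ := Choice.on leavitt.
HB.instance Definition _ := EqQuotient.on leavitt.

Local Notation pi := (\pi_leavitt)%qT.

Lemma leavitt_eqP t u : pi t = pi u <-> lcong t u.
Proof. by split=> [/eqmodP/asboolP|h] //; apply/eqmodP/asboolP. Qed.

Lemma leavitt_repr t : lcong (repr (pi t)) t.
Proof. by apply/leavitt_eqP; rewrite reprK. Qed.

Definition leavitt_const (c : K) : leavitt := pi (LConst c).
Definition leavitt_gen (i : 'I_d) : leavitt := pi (LGen i).
Definition leavitt_star (i : 'I_d) : leavitt := pi (LStar i).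
Definition leavitt_add (x y : leavitt) : leavitt := pi (LAdd (repr x) (repr y)).
Definition leavitt_opp (x : leavitt) : leavitt := pi (LOpp (repr x)).
Definition leavitt_mul (x y : leavitt) : leavitt := pi (LMul (repr x) (repr y)).
Definition leavitt_scale (c : K) (x : leavitt) : leavitt :=
  leavitt_mul (leavitt_const c) x.

Lemma leavitt_addE t u : leavitt_add (pi t) (pi u) = pi (LAdd t u).
Proof. by apply/leavitt_eqP/lcong_add; apply: leavitt_repr. Qed.

Lemma leavitt_oppE t : leavitt_opp (pi t) = pi (LOpp t).
Proof. by apply/leavitt_eqP/lcong_opp; apply: leavitt_repr. Qed.

Lemma leavitt_mulE t u : leavitt_mul (pi t) (pi u) = pi (LMul t u).
Proof. by apply/leavitt_eqP/lcong_mul; apply: leavitt_repr. Qed.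

Lemma leavitt_ind (P : leavitt -> Prop) : (forall t, P (pi t)) -> forall x, P x.
Proof. by move=> h x; rewrite -[x]reprK. Qed.

Fact leavitt_addA : associative leavitt_add.
Proof.
elim/leavitt_ind => t; elim/leavitt_ind => u; elim/leavitt_ind => v.
by rewrite !leavitt_addE; apply/leavitt_eqP/lcong_addA.
Qed.

Fact leavitt_addC : commutative leavitt_add.
Proof.
elim/leavitt_ind => t; elim/leavitt_ind => u.
by rewrite !leavitt_addE; apply/leavitt_eqP/lcong_addC.
Qed.

Fact leavitt_add0 : left_id (leavitt_const 0) leavitt_add.
Proof.
by elim/leavitt_ind => t; rewrite leavitt_addE; apply/leavitt_eqP/lcong_add0.
Qed.

Fact leavitt_addN : left_inverse (leavitt_const 0) leavitt_opp leavitt_add.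
Proof.
elim/leavitt_ind => t; rewrite leavitt_oppE leavitt_addE.
exact/leavitt_eqP/lcong_addN.
Qed.

Fact leavitt_mulA : associative leavitt_mul.
Proof.
elim/leavitt_ind => t; elim/leavitt_ind => u; elim/leavitt_ind => v.
by rewrite !leavitt_mulE; apply/leavitt_eqP/lcong_mulA.
Qed.

Fact leavitt_constC c x :
  leavitt_mul (leavitt_const c) x = leavitt_mul x (leavitt_const c).
Proof.
by elim/leavitt_ind: x => t; rewrite !leavitt_mulE; apply/leavitt_eqP/lcong_constC.
Qed.

Fact leavitt_mul1 : left_id (leavitt_const 1) leavitt_mul.
Proof.
by elim/leavitt_ind => t; rewrite leavitt_mulE; apply/leavitt_eqP/lcong_mul1.
Qed.

Fact leavitt_mulr1 : right_id (leavitt_const 1) leavitt_mul.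
Proof. by move=> x; rewrite -leavitt_constC leavitt_mul1. Qed.

Fact leavitt_mulDl : left_distributive leavitt_mul leavitt_add.
Proof.
elim/leavitt_ind => t; elim/leavitt_ind => u; elim/leavitt_ind => v.
by rewrite !(leavitt_addE, leavitt_mulE); apply/leavitt_eqP/lcong_mulDl.
Qed.

Fact leavitt_mulDr : right_distributive leavitt_mul leavitt_add.
Proof.
elim/leavitt_ind => t; elim/leavitt_ind => u; elim/leavitt_ind => v.
by rewrite !(leavitt_addE, leavitt_mulE); apply/leavitt_eqP/lcong_mulDr.
Qed.

Fact leavitt_constD c e :
  leavitt_const (c + e) = leavitt_add (leavitt_const c) (leavitt_const e).
Proof. by rewrite leavitt_addE; apply/leavitt_eqP/lcong_constD. Qed.

Fact leavitt_constM c e :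
  leavitt_const (c * e) = leavitt_mul (leavitt_const c) (leavitt_const e).
Proof. by rewrite leavitt_mulE; apply/leavitt_eqP/lcong_constM. Qed.


HB.instance Definition _ := GRing.isZmodule.Build leavitt
  leavitt_addA leavitt_addC leavitt_add0 leavitt_addN.
HB.instance Definition _ := GRing.Zmodule_isPzRing.Build leavitt
  leavitt_mulA leavitt_mul1 leavitt_mulr1 leavitt_mulDl leavitt_mulDr.

Fact leavitt_scaleA c e x :
  leavitt_scale c (leavitt_scale e x) = leavitt_scale (c * e) x.
Proof. by rewrite /leavitt_scale leavitt_mulA leavitt_constM. Qed.

Fact leavitt_scaleDl x : {morph leavitt_scale^~ x : c e / c + e}.
Proof. by move=> c e; rewrite /leavitt_scale leavitt_constD leavitt_mulDl. Qed.

Fact leavitt_scaleDr : right_distributive leavitt_scale +%R.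
Proof. by move=> c x y; apply: leavitt_mulDr. Qed.

HB.instance Definition _ := GRing.Zmodule_isLmodule.Build K leavitt
  leavitt_scaleA leavitt_mul1 leavitt_scaleDr leavitt_scaleDl.

Lemma leavitt_scaleAl (c : K) (x y : leavitt) : c *: (x * y) = c *: x * y.
Proof. exact: leavitt_mulA. Qed.

Lemma leavitt_scaleAr (c : K) (x y : leavitt) : c *: (x * y) = x * (c *: y).
Proof.
rewrite /GRing.scale /= /leavitt_scale /GRing.mul /= !leavitt_mulA.
by rewrite leavitt_constC.
Qed.

Lemma leavitt_constE c : leavitt_const c = c *: (1 : leavitt).
Proof. by rewrite [RHS]leavitt_mulr1. Qed.

Lemma pi_leavitt_add t u : pi (LAdd t u) = pi t + pi u.
Proof. by rewrite [RHS]leavitt_addE. Qed.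

Lemma pi_leavitt_opp t : pi (LOpp t) = - pi t.
Proof. by rewrite [RHS]leavitt_oppE. Qed.

Lemma pi_leavitt_mul t u : pi (LMul t u) = pi t * pi u.
Proof. by rewrite [RHS]leavitt_mulE. Qed.

Lemma leavitt_star_gen i j :
  leavitt_star i * leavitt_gen j = (i == j)%:R :> leavitt.
Proof.
rewrite [LHS]leavitt_mulE.
have -> : (i == j)%:R = leavitt_const (i == j)%:R.
  by rewrite leavitt_constE scaler_nat.
exact/leavitt_eqP/lcong_star_gen.
Qed.

Lemma leavitt_gen_star :
  \sum_(i < d) leavitt_gen i * leavitt_star i = 1 :> leavitt.
Proof.
transitivity (pi (LConst 1)) => //.
rewrite -((leavitt_eqP _ _).2 (lcong_gen_star K d)).
elim/big_ind2: _ => // [x t y u -> ->|i _]; first by rewrite pi_leavitt_add.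
by rewrite pi_leavitt_mul.
Qed.

End LeavittConstruction.

(* For d > 0 the ring is nontrivial, hence an algType: it acts on the functions
   nat -> K through the bijections m |-> d * m + i onto residue classes. *)
Section LeavittNontrivial.
Context (K : fieldType) (n : nat).
Local Notation d := n.+1.

Fixpoint lrep (t : lterm K d) (f : nat -> K) (m : nat) : K :=
  match t with
  | LConst c => c * f m
  | LGen i => if (m %% d == i)%N then f (m %/ d)%N else 0
  | LStar i => f (m * d + i)%N
  | LAdd t u => lrep t f m + lrep u f m
  | LOpp t => - lrep t f m
  | LMul t u => lrep t (lrep u f) m
  end.

Lemma lrep_ext t f g : f =1 g -> lrep t f =1 lrep t g.
Proof.
elim: t f g => [c|i|i|t IHt u IHu|t IHt|t IHt u IHu] f g fg m /=;
  rewrite ?fg ?(IHt _ _ fg) ?(IHu _ _ fg) //.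
exact/IHt/IHu.
Qed.

Lemma lrepD t f g m :
  lrep t (fun k => f k + g k) m = lrep t f m + lrep t g m.
Proof.
elim: t f g m => [c|i|i|t IHt u IHu|t IHt|t IHt u IHu] f g m //=.
- exact: mulrDr.
- by case: ifP; rewrite ?addr0.
- by rewrite IHt IHu addrACA.
- by rewrite IHt opprD.
by rewrite -IHt; apply: lrep_ext => k; apply: IHu.
Qed.

Lemma lrepZ t c f m : lrep t (fun k => c * f k) m = c * lrep t f m.
Proof.
elim: t f m => [e|i|i|t IHt u IHu|t IHt|t IHt u IHu] f m //=.
- exact: mulrCA.
- by case: ifP; rewrite ?mulr0.
- by rewrite IHt IHu mulrDr.
- by rewrite IHt mulrN.
by rewrite -IHt; apply: lrep_ext => k; apply: IHu.
Qed.

Lemma lrep_cong t u : lcong t u -> forall f, lrep t f =1 lrep u f.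
Proof.
elim=> //=.
- by move=> t' u' _ IH f m; rewrite IH.
- by move=> t' u' v _ IH _ IH' f m; rewrite IH IH'.
- by move=> t1 t2 u1 u2 _ IH _ IH' f m; rewrite IH IH'.
- by move=> t1 t2 _ IH f m; rewrite IH.
- by move=> t1 t2 u1 u2 _ IH _ IH' f m; rewrite IH; apply/lrep_ext/IH'.
- by move=> * ? /=; rewrite addrA.
- by move=> * ? /=; rewrite addrC.
- by move=> * ? /=; rewrite mul0r add0r.
- by move=> * ? /=; rewrite addNr mul0r.
- by move=> * ? /=; rewrite mul1r.
- by move=> t1 u1 v f m /=; rewrite lrepD.
- by move=> * ? /=; rewrite mulrDl.
- by move=> * ? /=; rewrite mulrA.
- by move=> c t1 f m /=; rewrite lrepZ.
- move=> i j f m /=; rewrite modnMDl divnMDl // modn_small ?divn_small ?ltn_ord //.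
  by rewrite addn0 val_eqE; case: eqP => _ /=; rewrite ?mul1r ?mul0r.
move=> f m /=; transitivity (\sum_(i < d) lrep (LMul (LGen i) (LStar i)) f m).
  elim/big_ind2: _ => //= [|t1 x u1 y -> -> //]; exact: mul0r.
rewrite (bigD1 (inord (m %% d))) //= big1 => [|i].
  by rewrite inordK ?ltn_pmod // eqxx -divn_eq addr0 mul1r.
by rewrite -val_eqE /= inordK ?ltn_pmod // eq_sym => /negbTE ->.
Qed.

Fact leavitt_oner_neq0 : (1 : leavitt K d) != 0.
Proof.
apply/eqP => /leavitt_eqP/lrep_cong/(_ (fun=> 1) 0%N)/eqP /=.
by rewrite !mulr1 oner_eq0.
Qed.

HB.instance Definition _ :=
  GRing.PzSemiRing_isNonZero.Build (leavitt K d) leavitt_oner_neq0.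
HB.instance Definition _ :=
  GRing.LSemiModule_isLSemiAlgebra.Build K (leavitt K d) (@leavitt_scaleAl K d).
HB.instance Definition _ :=
  GRing.LSemiAlgebra_isSemiAlgebra.Build K (leavitt K d) (@leavitt_scaleAr K d).

End LeavittNontrivial.

(* The presentation: universal property of L_K(1,d). *)
Section LeavittUniversal.
Context (K : fieldType) (n : nat).
Local Notation d := n.+1.
Context (A : algType K) (b bs : 'I_d -> A).

Fixpoint leval (t : lterm K d) : A :=
  match t with
  | LConst c => c%:A
  | LGen i => b i
  | LStar i => bs i
  | LAdd t u => leval t + leval u
  | LOpp t => - leval t
  | LMul t u => leval t * leval u
  end.

Hypothesis star_gen : forall i j, bs i * b j = (i == j)%:R.
Hypothesis gen_star : \sum_(i < d) b i * bs i = 1.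

Lemma leval_cong t u : lcong t u -> leval t = leval u.
Proof.
elim=> //=.
- by move=> t' u' v _ -> _ ->.
- by move=> t1 t2 u1 u2 _ -> _ ->.
- by move=> t1 t2 _ ->.
- by move=> t1 t2 u1 u2 _ -> _ ->.
- by move=> *; rewrite addrA.
- by move=> *; rewrite addrC.
- by move=> *; rewrite scale0r add0r.
- by move=> *; rewrite addNr scale0r.
- by move=> *; rewrite mulrA.
- by move=> *; rewrite scale1r mul1r.
- by move=> *; rewrite mulrDl.
- by move=> *; rewrite mulrDr.
- by move=> *; rewrite scalerDl.
- by move=> c e; rewrite -scalerAl mul1r scalerA.
- by move=> c t1; rewrite -scalerAl -scalerAr mul1r mulr1.
- by move=> i j; rewrite star_gen scaler_nat.
rewrite scale1r -gen_star; elim/big_ind2: _ => //= [|t1 x u1 y -> -> //].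
exact: scale0r.
Qed.

Definition leavitt_lift (x : leavitt K d) : A := leval (repr x).

Lemma leavitt_lift_pi t : leavitt_lift (\pi_(leavitt K d)%qT t) = leval t.
Proof. exact/leval_cong/leavitt_repr. Qed.

Theorem leavitt_universal :
  exists! f : leavitt K d -> A,
    [/\ forall x y, f (x + y) = f x + f y, forall x y, f (x * y) = f x * f y,
        forall c x, f (c *: x) = c *: f x, f 1 = 1
      & forall i, f (leavitt_gen K i) = b i /\ f (leavitt_star K i) = bs i].
Proof.
exists leavitt_lift; split.
  have liftM x y : leavitt_lift (x * y) = leavitt_lift x * leavitt_lift y.
    by rewrite [LHS]leavitt_lift_pi.
  have liftC c : leavitt_lift (leavitt_const d c) = c%:A.
    by rewrite [LHS]leavitt_lift_pi.
  split=> // [x y|c x||i].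
  - by rewrite [LHS]leavitt_lift_pi.
  - by rewrite [LHS]liftM liftC -scalerAl mul1r.
  - by rewrite [LHS]liftC scale1r.
  by rewrite !leavitt_lift_pi.
move=> f [fD fM fZ f1 fg]; apply/funext; elim/leavitt_ind => t.
rewrite leavitt_lift_pi; symmetry.
elim: t => [c|i|i|t IHt u IHu|t IHt|t IHt u IHu] /=.
- by rewrite -[LHS]/(f (leavitt_const d c)) leavitt_constE fZ f1.
- by have [] := fg i.
- by have [] := fg i.
- by rewrite pi_leavitt_add fD IHt IHu.
- by rewrite pi_leavitt_opp -scaleN1r fZ IHt scaleN1r.
by rewrite pi_leavitt_mul fM IHt IHu.
Qed.

End LeavittUniversal.

(* Units of a ring whose invertibility need not be decidable: an element is a
   pair (u, u^-1). *)
Section UnitGroup.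
Context (R : pzRingType).

Definition is_inverse_pair : pred (R * R) :=
  fun u => (u.1 * u.2 == 1) && (u.2 * u.1 == 1).

Definition unit_group : Type := {u : R * R | is_inverse_pair u}.

HB.instance Definition _ := Choice.on unit_group.
HB.instance Definition _ := SubType.on unit_group.

Definition unit_val (u : unit_group) : R := (val u).1.

Fact unit_one_proof : is_inverse_pair (1, 1).
Proof. by rewrite /is_inverse_pair /= mulr1 eqxx. Qed.

Fact unit_mul_proof (u v : unit_group) :
  is_inverse_pair ((val u).1 * (val v).1, (val v).2 * (val u).2).
Proof.
case: u => [[x x'] /= /andP[/eqP xx' /eqP x'x]].
case: v => [[y y'] /= /andP[/eqP yy' /eqP y'y]].
rewrite /is_inverse_pair /= mulrA -(mulrA x) yy' mulr1 xx'.
by rewrite mulrA -(mulrA y') x'x mulr1 y'y eqxx.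
Qed.

Fact unit_inv_proof (u : unit_group) : is_inverse_pair ((val u).2, (val u).1).
Proof. by rewrite /is_inverse_pair /= andbC; apply: (valP u). Qed.

Definition unit_one : unit_group := Sub (1, 1) unit_one_proof.
Definition unit_mul (u v : unit_group) : unit_group :=
  Sub ((val u).1 * (val v).1, (val v).2 * (val u).2) (unit_mul_proof u v).
Definition unit_inv (u : unit_group) : unit_group :=
  Sub ((val u).2, (val u).1) (unit_inv_proof u).

Lemma unit_val_inj : injective unit_val.
Proof.
move=> u v uv; apply/val_inj.
rewrite [LHS]surjective_pairing [RHS]surjective_pairing.
congr pair => //.
have /andP[_ /eqP u'u] := valP u; have /andP[/eqP vv' _] := valP v.
have uv1 : (val u).1 = (val v).1 by [].
by rewrite -[LHS]mulr1 -vv' -uv1 mulrA u'u mul1r.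
Qed.

Lemma unit_valP (x : R) :
  (exists u, unit_val u = x) <-> (exists y, x * y = 1 /\ y * x = 1).
Proof.
split=> [[u <-]|[y [xy yx]]].
  by have /andP[/eqP uu' /eqP u'u] := valP u; exists (val u).2.
have p : is_inverse_pair (x, y) by rewrite /is_inverse_pair /= xy yx eqxx.
by exists (Sub (x, y) p).
Qed.

Fact unit_mulA : associative unit_mul.
Proof. by move=> u v w; apply/unit_val_inj; rewrite /unit_val /= mulrA. Qed.

Fact unit_mul1 : left_id unit_one unit_mul.
Proof. by move=> u; apply/unit_val_inj; rewrite /unit_val /= mul1r. Qed.

Fact unit_mulr1 : right_id unit_one unit_mul.
Proof. by move=> u; apply/unit_val_inj; rewrite /unit_val /= mulr1. Qed.

Fact unit_mulV : left_inverse unit_one unit_inv unit_mul.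
Proof.
move=> u; apply/unit_val_inj; rewrite /unit_val /=.
by case/andP: (valP u) => _ /eqP.
Qed.

Fact unit_mulrV : right_inverse unit_one unit_inv unit_mul.
Proof.
move=> u; apply/unit_val_inj; rewrite /unit_val /=.
by case/andP: (valP u) => /eqP.
Qed.

HB.instance Definition _ := isGroup.Build unit_group
  unit_mulA unit_mul1 unit_mulr1 unit_mulV unit_mulrV.

End UnitGroup.

Inductive generated_by (G : groupType) (s : seq G) : G -> Prop :=
| generated_mem x : x \in s -> generated_by s x
| generated_one : generated_by s 1%g
| generated_mul x y :
    generated_by s x -> generated_by s y -> generated_by s (x * y)%g
| generated_inv x : generated_by s x -> generated_by s x^-1%g.

Definition finitely_generated (G : groupType) : Prop :=
  exists s : seq G, forall x : G, generated_by s x.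

(* Main.v *)
Require Import Defs.
From HB Require Import structures.
From mathcomp Require Import all_boot all_algebra.
From mathcomp Require Import zify ring.
From mathcomp Require Import boolp classical_sets cardinality.

(* If the unit group is finitely generated, only finitely many scalars c_1, ..., c_r
   occur in terms for the generators and their inverses.  In the representation of
   L_K(1,d) on functions nat -> K the generators a_i, a_i^* have entries 0 and 1, so
   comparing entries shows that every nonzero scalar lies in Z[c_1, ..., c_r].  Hence
   the field K is a finitely generated ring, and so it is finite.

   Conversely, let p_w be the product of the a_i along a word w, q_w its star, and let
   F be the span of the p_w, a free algebra.  The transvections 1 + p_v c q_w with v, w
   incomparable for the prefix order generate, by commutators and additivity, a group
   that needs only finitely many of them when K is finite.  Let u be a unit.  For
   words v of a fixed large length the elements u p_v lie in F and are a free basis of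
   a right ideal which contains all p_w with |w| = m, for some m.  Multiplying u on
   the right by transvections and refining the words v changes this basis by elementary
   operations and by the expansions e -> (e a_1, ..., e a_d).  Making the lowest
   monomials prefix-incomparable, and then expanding the basis elements whose lowest
   monomial is shorter than m, turns the ideal into F_{>= m}; making the highest
   monomials prefix-incomparable afterwards makes the basis homogeneous of degree m and
   triangular.  What remains is a triangular matrix over K times an element of the
   Higman-Thompson group, and the latter is a product of transpositions of words. *)

Set Implicit Arguments.
Unset Strict Implicit.
Unset Printing Implicit Defensive.

Import GRing.Theory.
Local Open Scope ring_scope.

(** * Fields that are finitely generated rings *)

Section Adjunction.
Context (K : fieldType).

Definition adjoined (S : subringClosed K) (c : K) : {pred K} :=
  [pred x | `[< exists2 p, p \is a polyOver S & x = p.[c] >]].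

Lemma adjoinedP (S : subringClosed K) c x :
  reflect (exists2 p, p \is a polyOver S & x = p.[c]) (x \in adjoined S c).
Proof. exact: asboolP. Qed.

Fact adjoined_closed (S : subringClosed K) c : subring_closed (adjoined S c).
Proof.
split=> [|x y /adjoinedP[p pS ->] /adjoinedP[q qS ->]|
          x y /adjoinedP[p pS ->] /adjoinedP[q qS ->]]; apply/adjoinedP.
- by exists 1; rewrite ?rpred1 ?hornerC.
- by exists (p - q); rewrite ?rpredB // hornerD hornerN.
- by exists (p * q); rewrite ?rpredM // hornerM.
Qed.

HB.instance Definition _ S c := GRing.isSubringClosed.Build K (adjoined S c)
  (adjoined_closed S c).

Definition adjoin (S : subringClosed K) (c : K) : subringClosed K := adjoined S c.

Lemma mem_adjoin (S : subringClosed K) c x : x \in S -> x \in adjoin S c.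
Proof. by move=> xS; apply/adjoinedP; exists x%:P; rewrite ?polyOverC ?hornerC. Qed.

Lemma adjoin_gen (S : subringClosed K) c : c \in adjoin S c.
Proof. by apply/adjoinedP; exists 'X; rewrite ?polyOverX ?hornerX. Qed.

Lemma adjoin_sub (S T : subringClosed K) c :
  {subset S <= T} -> c \in T -> {subset adjoin S c <= T}.
Proof.
move=> ST cT x /adjoinedP[p /polyOverP pS ->].
by rewrite rpred_horner //; apply/polyOverP => i; apply/ST.
Qed.

Lemma adjoin_inv_denom (S : subringClosed K) s x :
  s \in S -> s != 0 -> x \in adjoin S s^-1 -> exists N, s ^+ N * x \in S.
Proof.
move=> sS s0 /adjoinedP[p pS ->].
elim/poly_ind: p pS => [_|p c IHp]; first by exists 0%N; rewrite horner0 mulr0 rpred0.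
move=> pcS; have /IHp[N sN] : p \is a polyOver S.
  apply/polyOverP => i; have /polyOverP/(_ i.+1) := pcS.
  by rewrite coefD coefMX coefC /= addr0.
have cS : c \in S.
  by have /polyOverP/(_ 0%N) := pcS; rewrite coefD coefMX coefC /= add0r.
exists N.+1; rewrite hornerD hornerM hornerX hornerC mulrDr rpredD //; last first.
  by rewrite rpredM // rpredX.
by rewrite exprSr mulrACA divff // mulr1.
Qed.

(** The determinant trick: [B] is a nonzero eigenvector for [x], so [x] is a root of a
    characteristic polynomial, which is monic over [S]. *)
Lemma eigenvalue_integral (S : subringClosed K) (I : finType) (B : I -> K)
    (M : I -> I -> K) x :
  (forall i j, M i j \in S) -> (forall i, x * B i = \sum_j M i j * B j) ->
  (exists i, B i != 0) ->
  exists p, [/\ p \is monic, p \is a polyOver S & root p x].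
Proof.
move=> MS xB [i0 Bi0].
(* Transposed, because eigenvectors are row vectors. *)
pose A : 'M[K]_#|I| := \matrix_(i, j) M (enum_val j) (enum_val i).
exists (char_poly A); split; first exact: char_poly_monic.
  rewrite rpred_sum // => s _; rewrite rpredMsign rpred_prod // => i _.
  by rewrite !mxE rpredB ?rpredMn ?polyOverX ?polyOverC.
rewrite -eigenvalue_root_char; apply/eigenvalueP.
exists (\row_i B (enum_val i)).
  apply/rowP => i; rewrite !mxE xB.
  rewrite [RHS](reindex_onto enum_val enum_rank) /=; last first.
    by move=> j _; rewrite enum_rankK.
  by apply: eq_big => [j|j _]; rewrite ?enum_valK ?eqxx // !mxE mulrC.
apply/negP => /eqP/rowP/(_ (enum_rank i0)); rewrite !mxE enum_rankK => /eqP.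
exact/negP.
Qed.

Definition module_finite (S : subringClosed K) :=
  exists (I : finType) (B : I -> K), forall x,
    exists f : I -> K, (forall i, f i \in S) /\ x = \sum_i f i * B i.

(** A subring over which a field is integral is itself a field. *)
Lemma module_finite_inv (S : subringClosed K) y :
  module_finite S -> y \in S -> y^-1 \in S.
Proof.
move=> [I [B spanB]] yS; have [->|y0] := eqVneq y 0; first by rewrite invr0 rpred0.
have [M MP] := choice (fun i => spanB (y^-1 * B i)).
have [nzB|B0] := pselect (exists i, B i != 0); last first.
  have [f [_ /esym/eqP]] := spanB 1; rewrite big1 => [|i _]; last first.
    by have [->|Bi] := eqVneq (B i) 0; rewrite ?mulr0 //; case: B0; exists i.
  by rewrite eq_sym oner_eq0.
have [p [pm pS py]] :=
  eigenvalue_integral (fun i => (MP i).1) (fun i => (MP i).2) nzB.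
have p_gt0 : (0 < size p)%N by rewrite size_poly_gt0 monic_neq0.
have [n sz_p] : exists n, size p = n.+2.
  case: (size p) p_gt0 (root_size_gt1 (monic_neq0 pm) py) => [|[|n]] //; by exists n.
(* The monic equation of [y^-1], of degree [n.+1], multiplied by [y ^+ n]. *)
have -> : y^-1 = - \sum_(i < n.+1) p`_i * y ^+ (n - i).
  apply/eqP; rewrite -addr_eq0; apply/eqP.
  transitivity (y ^+ n * p.[y^-1]); last by rewrite (rootP py) mulr0.
  rewrite horner_coef sz_p [in RHS]big_ord_recr /= mulrDr addrC; congr (_ + _); last first.
    move/monicP: pm; rewrite lead_coefE sz_p /= => ->.
    by rewrite mul1r exprS mulrCA exprVn divff ?mulr1 ?expf_neq0.
  rewrite mulr_sumr; apply: eq_bigr => i _.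
  rewrite mulrCA; congr (_ * _).
  by rewrite exprB ?unitfE ?exprVn // -ltnS.
rewrite rpredN rpred_sum // => i _; rewrite rpredM ?rpredX //.
exact: (polyOverP pS).
Qed.

(** Remainders modulo the monic [p] represent all values at its root [c]. *)
Lemma monic_span (T : subringClosed K) c p :
  p \is monic -> p \is a polyOver T -> root p c ->
  forall x, x \in adjoin T c ->
  exists f : 'I_(size p).-1 -> K, (forall i, f i \in T) /\ x = \sum_i f i * c ^+ i.
Proof.
move=> pm pT pc x xTc; set n := (size p).-1.
have sz_p : size p = n.+1.
  by rewrite /n prednK // size_poly_gt0 monic_neq0.
suff [h [hT sz_h ->]] : exists h, [/\ h \is a polyOver T, (size h <= n)%N & x = h.[c]].
  exists (fun i => h`_i); split=> [i|]; first exact: (polyOverP hT).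
  exact: horner_coef_wide.
have{xTc} [h hT ->] := adjoinedP _ _ _ xTc.
elim/poly_ind: h hT => [_|h a IHh].
  by exists 0; rewrite rpred0 size_poly0.
move=> haT; have hT : h \is a polyOver T.
  apply/polyOverP => i; have /polyOverP/(_ i.+1) := haT.
  by rewrite coefD coefMX coefC /= addr0.
have aT : a \in T.
  by have /polyOverP/(_ 0%N) := haT; rewrite coefD coefMX coefC /= add0r.
have{IHh hT} [g [gT sz_g hg]] := IHh hT.
exists (g * 'X + a%:P - g`_n.-1 *: p); split.
- by rewrite rpredB ?rpredD ?rpredM ?polyOverX ?polyOverC ?polyOverZ ?(polyOverP gT).
- have n_gt0 : (0 < n)%N.
    by rewrite -ltnS -sz_p (root_size_gt1 (monic_neq0 pm) pc).
  apply/leq_sizeP => j; rewrite leq_eqVlt coefB coefD coefMX coefC coefZ.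
  case/predU1P => [<-|lt_nj].
    move/monicP: pm; rewrite lead_coefE sz_p /= => ->.
    by case: (n) n_gt0 => // n' _ /=; rewrite addr0 mulr1 subrr.
  rewrite [p`_j]nth_default ?sz_p // mulr0 subr0.
  by case: j lt_nj => // j lt_nj /=; rewrite addr0 nth_default // (leq_trans sz_g).
by rewrite !hornerE (rootP pc) mulr0 subr0 hg.
Qed.

(** The element [s] is integral over [T]; once powers of ['X] are cancelled, the constant term of
    its equation is a nonzero multiple of [s]. *)
Lemma integral_denominator (T : subringClosed K) c p s :
  p \is monic -> p \is a polyOver T -> root p c -> s \in adjoin T c -> s != 0 ->
  exists t, [/\ t \in T, t != 0 & t / s \in adjoin T c].
Proof.
move=> pm pT pc sTc s0.
have p_gt1 := root_size_gt1 (monic_neq0 pm) pc.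
have spanM (i : 'I_(size p).-1) : exists f : 'I_(size p).-1 -> K,
    (forall j, f j \in T) /\ s * c ^+ i = \sum_j f j * c ^+ j.
  by apply: monic_span => //; rewrite rpredM ?rpredX ?adjoin_gen.
have [M MP] := choice spanM.
have [|P [Pm PT Ps]] :=
  eigenvalue_integral (fun i => (MP i).1) (fun i => (MP i).2).
  have i0 : (0 < (size p).-1)%N by case: (size p) p_gt1 => [|[]].
  by exists (Ordinal i0); rewrite expr0 oner_neq0.
have {Pm}: P != 0 by exact: monic_neq0.
elim/poly_ind: P PT Ps => [|P a IHP] PaT; first by rewrite eqxx.
have PT : P \is a polyOver T.
  apply/polyOverP => i; have /polyOverP/(_ i.+1) := PaT.
  by rewrite coefD coefMX coefC /= addr0.
have aT : a \in T.
  by have /polyOverP/(_ 0%N) := PaT; rewrite coefD coefMX coefC /= add0r.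
rewrite /root !hornerE; have [->|a0 Ps _] := eqVneq a 0.
  rewrite !addr0 mulf_eq0 (negPf s0) orbF => Ps PX0; apply: IHP => //.
  by apply: contraNneq PX0 => ->; rewrite mul0r.
exists a; split=> //; have -> : a / s = - P.[s].
  by apply: (mulIf s0); rewrite mulfVK // mulNr; apply/eqP; rewrite -addr_eq0 addrC.
rewrite rpredN; apply: (adjoin_sub (@mem_adjoin T c) sTc).
by apply/adjoinedP; exists P.
Qed.

Lemma module_finite_trans (S T : subringClosed K) (I : finType) (B : I -> K) :
  (forall x, x \in S ->
     exists f : I -> K, (forall i, f i \in T) /\ x = \sum_i f i * B i) ->
  module_finite S -> module_finite T.
Proof.
move=> spanS [J [C spanC]]; exists (I * J)%type, (fun ij => B ij.1 * C ij.2) => x.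
have [f [fS ->]] := spanC x.
have [g gP] := choice (fun j => spanS _ (fS j)).
exists (fun ij => g ij.2 ij.1); split=> [ij|]; first exact: (gP _).1.
rewrite -(pair_bigA_idem _ (fun i j => g j i * (B i * C j))) /= ?addr0 //.
rewrite exchange_big /=; apply: eq_bigr => j _.
by rewrite (gP j).2 mulr_suml; apply: eq_bigr => i _; rewrite mulrA.
Qed.

(** Removes one generator in Zariski's lemma: [c] must be algebraic over [S], and inverting one
    element of [S] makes [c] integral and [s] invertible. *)
Lemma module_finite_adjoin (S : subringClosed K) c s :
  s \in adjoin S c -> s != 0 -> module_finite (adjoin (adjoin S c) s^-1) ->
  exists2 r, r \in S & r != 0 /\ module_finite (adjoin S r^-1).
Proof.
move=> sSc s0 finK.
have [[p [pS p0 pc]]|trc] :=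
  pselect (exists p, [/\ p \is a polyOver S, p != 0 & p.[c] = 0]); last first.
  have [sg sgS def_s] := adjoinedP _ _ _ sSc.
  (* As in Euclid's argument, [Y] is prime to [sg]. By finiteness [Y.[c]] becomes invertible once
     [s] is inverted, so for transcendental [c] the polynomial [Y] divides a power of [sg], which is
     absurd. *)
  pose Y := 1 + 'X * sg.
  have sg0 : sg != 0 by apply: contraNneq s0 => sg0; rewrite def_s sg0 horner0.
  have sz_Y : (1 < size Y)%N.
    by rewrite /Y addrC size_addl ?size_mul ?polyX_eq0 ?size_polyX ?size_poly1 //=
         ltnS size_poly_gt0.
  have YS : Y \is a polyOver S by rewrite rpredD ?rpred1 ?rpredM ?polyOverX.
  have Yc : Y.[c] != 0.
    apply/eqP => Yc; case: trc; exists Y; split=> //.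
    by rewrite -size_poly_gt0 (ltn_trans _ sz_Y).
  have [N] : exists N, s ^+ N * Y.[c]^-1 \in adjoin S c.
    apply: adjoin_inv_denom => //.
    by apply: module_finite_inv => //; apply/mem_adjoin/adjoinedP; exists Y.
  case/adjoinedP => G GS def_G.
  have /eqP sgN : sg ^+ N - Y * G == 0.
    apply/negPn/negP => nz; case: trc; exists (sg ^+ N - Y * G); split=> //.
      by rewrite rpredB ?rpredX ?rpredM.
    by rewrite hornerD hornerN horner_exp hornerM -def_s -def_G mulrCA divff ?mulr1 ?subrr.
  have YsgN : Y %| sg ^+ N by rewrite (subr0_eq sgN) dvdp_mulr.
  have cop : coprimep Y sg.
    apply/Bezout_coprimepP; exists (1, - 'X) => /=.
    by rewrite mul1r mulNr addrK eqpxx.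
  have := coprimep_expr N cop; rewrite /coprimep.
  have /eqp_size -> : gcdp Y (sg ^+ N) %= Y by apply: dvdp_gcd_idl.
  by rewrite gtn_eqF.
have lc0 : lead_coef p != 0 by rewrite lead_coef_eq0.
have lcS : lead_coef p \in S by exact: (polyOverP pS).
pose T0 := adjoin S (lead_coef p)^-1.
pose p1 := (lead_coef p)^-1 *: p.
have p1m : p1 \is monic by rewrite monicE lead_coefZ mulVf.
have p1T0 : p1 \is a polyOver T0.
  apply/polyOverP => i; rewrite coefZ rpredM ?adjoin_gen ?mem_adjoin //.
  exact: (polyOverP pS).
have p1c : root p1 c by rewrite /root hornerZ pc mulr0.
have SsubT0 : {subset S <= T0} by exact: mem_adjoin.
have sT0c : s \in adjoin T0 c.
  by apply: adjoin_sub sSc; rewrite ?adjoin_gen // => x /SsubT0/mem_adjoin.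
have [t [tT0 t0 tsT0]] := integral_denominator p1m p1T0 p1c sT0c s0.
have [N rS] := adjoin_inv_denom lcS lc0 tT0.
(* Powers of the leading coefficient are cleared from [t], so that inverting [lead_coef p * a]
   inverts both the leading coefficient and [t]. *)
set a := lead_coef p ^+ N * t in rS.
have a0 : a != 0 by rewrite mulf_neq0 ?expf_neq0.
exists (lead_coef p * a); first by rewrite rpredM.
split; first by rewrite mulf_neq0.
pose T := adjoin S (lead_coef p * a)^-1.
have lcVT : (lead_coef p)^-1 \in T.
  have -> : (lead_coef p)^-1 = a * (lead_coef p * a)^-1.
    by rewrite invfM mulrCA divff ?mulr1.
  by rewrite rpredM ?adjoin_gen ?mem_adjoin.
have aVT : a^-1 \in T.
  have -> : a^-1 = lead_coef p * (lead_coef p * a)^-1.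
    by rewrite [(lead_coef p * a)^-1]invfM mulrA divff ?mul1r.
  by rewrite rpredM ?adjoin_gen ?mem_adjoin.
have T0T : {subset T0 <= T} by apply: adjoin_sub => // x; apply: mem_adjoin.
have tVT : t^-1 \in T.
  have -> : t^-1 = lead_coef p ^+ N * a^-1.
    by rewrite invfM mulrA divff ?mul1r ?expf_neq0.
  by rewrite rpredM ?rpredX //; apply/T0T/SsubT0.
have T0cT : {subset adjoin T0 c <= adjoin T c}.
  by apply: adjoin_sub; rewrite ?adjoin_gen // => x /T0T/mem_adjoin.
apply: module_finite_trans finK => x xS.
apply: (monic_span p1m _ p1c).
  by apply/polyOverP => i; apply/T0T/(polyOverP p1T0).
apply: adjoin_sub x xS; first apply: adjoin_sub; rewrite ?adjoin_gen //.
  by move=> x /SsubT0/T0T/mem_adjoin.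
have -> : s^-1 = t^-1 * (t / s) by rewrite mulKf.
by rewrite rpredM ?(T0cT _ tsT0) // mem_adjoin.
Qed.

(** The denominator [r] lets the induction over the generators pass through subrings that are not
    fields. *)
Lemma zariski (cs : seq K) (S : subringClosed K) :
  (forall x, x \in foldl adjoin S cs) ->
  exists2 r, r \in S & r != 0 /\ module_finite (adjoin S r^-1).
Proof.
elim: cs S => [|c cs IHcs] S /= genK.
  exists 1; rewrite ?rpred1 ?oner_neq0; split=> //.
  exists 'I_1, (fun=> 1) => x; exists (fun=> x); split=> [_|]; last first.
    by rewrite big_ord1 mulr1.
  exact/mem_adjoin/genK.
have [s sSc [s0 finK]] := IHcs _ genK.
exact: module_finite_adjoin sSc s0 finK.
Qed.

Definition int_image : {pred K} := [pred x | `[< exists z : int, x = z%:~R >]].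

Fact int_image_closed : subring_closed int_image.
Proof.
split=> [|x y /asboolP[z ->] /asboolP[t ->]|x y /asboolP[z ->] /asboolP[t ->]];
  apply/asboolP.
- by exists 1.
- by exists (z - t); rewrite rmorphB.
- by exists (z * t); rewrite rmorphM.
Qed.
HB.instance Definition _ := GRing.isSubringClosed.Build K int_image int_image_closed.

(** The field is finite over the image of the integers with [r] inverted. In characteristic [p] that
    ring is the prime field; in characteristic 0 it would be a field, which is impossible. *)
Lemma fg_ring_finite_field (cs : seq K) :
  (forall x, x \in foldl adjoin int_image cs) -> finite_set [set: K]%classic.
Proof.
move=> /zariski[r rZ [r0 finK]].
have [z def_r] : exists z : int, r = z%:~R by apply/asboolP.
have [[p pK]|char0] := pselect (exists p, p \in [pchar K]).
  have p_pr : prime p := pcharf_prime pK.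
  have pz0 : (p : int) != 0 by case: (p) p_pr.
  have TZ : {subset adjoin int_image r^-1 <= int_image}.
    apply: adjoin_sub => //.
    (* The Frobenius map fixes the image of the integers, which therefore already contains
       [r^-1]. *)
    have rp : r ^+ p = r.
      rewrite -[r ^+ p](pFrobenius_autE pK) def_r; exact: rmorph_int.
    have -> : r^-1 = r ^+ p.-2.
      apply: (mulfI (mulf_neq0 r0 r0)); rewrite mulfK // -expr2 -exprD -{1}rp.
      by congr (_ ^+ _); case: (p) (prime_gt1 p_pr) => [|[]].
    by rewrite rpredX.
  have [I [B spanB]] := finK.
  have -> : [set: K]%classic =
      ((fun f : {ffun I -> 'I_p} => \sum_i (f i)%:R * B i) @` [set: {ffun I -> 'I_p}])%classic.
    apply/seteqP; split=> // x _; have [f [fT ->]] := spanB x.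
    have fE i : exists k : 'I_p, f i = k%:R.
      have /asboolP[t ->] := TZ _ (fT i).
      have tp : (`|(t %% p)%Z|%N < p)%N.
        by rewrite -ltz_nat gez0_abs ?modz_ge0 ?ltz_pmod ?ltz_nat ?prime_gt0.
      exists (Ordinal tp) => /=.
      rewrite {1}(divz_eq t p) rmorphD rmorphM /= -[p%:~R]pmulrn (pcharf0 pK) mulr0 add0r.
      by rewrite -[in LHS](gez0_abs (modz_ge0 _ pz0)).
    have [g gE] := choice fE; exists (finfun g) => //.
    by apply: eq_bigr => i _; rewrite ffunE gE.
  by apply: finite_image; apply: finite_finset.
have /pcharf0P K0 : [pchar K] =i pred0.
  by move=> p; apply/negP => pK; apply: char0; exists p.
(* A prime above [|z|] would become invertible, hence would divide a power of [z]. *)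
have [l l_gt l_pr] := prime_above `|z|%N.
have lT : l%:R^-1 \in adjoin int_image r^-1.
  by rewrite module_finite_inv ?rpred_nat.
have [N /asboolP[m rN]] := adjoin_inv_denom rZ r0 lT.
have l0 : l%:R != 0 :> K by rewrite K0 -lt0n prime_gt0.
have zN : (z ^+ N - m * l)%:~R = 0 :> K.
  by rewrite rmorphB rmorphM rmorphXn /= -def_r -rN -pmulrn divfK ?subrr.
have {zN} zN : z ^+ N = m * l.
  apply/eqP; rewrite -subr_eq0 -absz_eq0 -K0.
  move: zN; set w := _ - _; case: w => k /eqP //.
  by rewrite NegzE rmorphN oppr_eq0.
have : (l %| `|z| ^ N)%N by rewrite -abszX zN abszM dvdn_mull.
rewrite Euclid_dvdX // => /andP[/dvdn_leq lz _].
have /lz : (0 < `|z|)%N by rewrite absz_gt0; apply: contraNneq r0 => z0; rewrite def_r z0.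
by rewrite leqNgt l_gt.
Qed.
End Adjunction.

(** * Scalars in a finitely generated unit group *)

Lemma mem_foldl_adjoin (K : fieldType) (cs : seq K) (S : subringClosed K) c :
  (c \in S) || (c \in cs) -> c \in foldl (@adjoin K) S cs.
Proof.
elim: cs S => [|e cs IHcs] S /=; first by rewrite orbF.
move=> cP; apply: IHcs; move: cP; rewrite inE orbCA.
case/or3P => [/eqP->|cS|->]; rewrite ?orbT //; apply/orP; left.
  exact: adjoin_gen.
exact: mem_adjoin.
Qed.

Fixpoint lterm_consts (K : Type) (d : nat) (t : lterm K d) : seq K :=
  match t with
  | LConst c => [:: c]
  | LGen _ | LStar _ => [::]
  | LAdd t u | LMul t u => lterm_consts t ++ lterm_consts u
  | LOpp t => lterm_consts t
  end.

(** Apart from multiplying by its scalars, a term only moves, drops, adds and negates values of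
    [f]. *)
Lemma lrep_closed (K : fieldType) (n : nat) (S : subringClosed K)
    (t : lterm K n.+1) (f : nat -> K) :
  {subset lterm_consts t <= S} -> (forall m, f m \in S) ->
  forall m, lrep t f m \in S.
Proof.
elim: t f => [c|i|i|t IHt u IHu|t IHt|t IHt u IHu] f /= tS fS m.
- by rewrite rpredM // tS // inE.
- by case: ifP; rewrite ?rpred0.
- exact: fS.
- by rewrite rpredD ?IHt ?IHu // => c ct; rewrite tS // mem_cat ct ?orbT.
- by rewrite rpredN IHt.
by apply: IHt => [c ct|k]; [|apply: IHu => // c ct]; rewrite tS // mem_cat ct ?orbT.
Qed.

Lemma unit_group_fg_finite (K : fieldType) (n : nat) :
  finitely_generated (unit_group (leavitt K n.+1)) -> finite_set [set: K]%classic.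
Proof.
move=> [s gen_s].
pose cs := flatten [seq lterm_consts (repr (val u).1) ++ lterm_consts (repr (val u).2)
                   | u : unit_group (leavitt K n.+1) <- s].
pose S := foldl (@adjoin K) (@int_image K) cs.
(* One suitable representative is asked for, since the [repr] of a product need not use the scalars
   of its factors. *)
pose good (x : leavitt K n.+1) :=
  exists2 t, x = \pi_(leavitt K n.+1)%qT t & {subset lterm_consts t <= S}.
have goodM x y : good x -> good y -> good (x * y).
  move=> [t -> tS] [u -> uS]; exists (LMul t u); first by rewrite pi_leavitt_mul.
  by move=> c; rewrite mem_cat => /orP[/tS|/uS].
have good_units u : generated_by s u -> good (val u).1 /\ good (val u).2.
  elim=> [{}u us||v w _ [v1 v2] _ [w1 w2]|v _ [v1 v2]].
  - have csS c : c \in cs -> c \in S by move=> ccs; rewrite mem_foldl_adjoin ?ccs ?orbT.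
    have ucs :
      {subset lterm_consts (repr (val u).1) ++ lterm_consts (repr (val u).2) <= S}.
      move=> c cu; apply/csS/flattenP.
      exists (lterm_consts (repr (val u).1) ++ lterm_consts (repr (val u).2)) => //.
      exact: map_f.
    split; [exists (repr (val u).1)|exists (repr (val u).2)]; rewrite ?reprK // => c cu.
      by apply: ucs; rewrite mem_cat cu.
    by apply: ucs; rewrite mem_cat cu orbT.
  - by split; exists (LConst 1) => // c; rewrite inE => /eqP->; rewrite rpred1.
  - by split; apply: goodM.
  - by [].
apply: (@fg_ring_finite_field K cs) => c; rewrite -/S.
have [->|c0] := eqVneq c 0; first exact: rpred0.
have ipP : is_inverse_pair (leavitt_const n.+1 c, leavitt_const n.+1 c^-1).
  by rewrite /is_inverse_pair /= !leavitt_constE -!scalerAl !mul1r !scalerA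
             mulfV // mulVf // !scale1r eqxx.
(* The constant [c] is a unit; acting on the constant function 1 reads it off as a value of a term
   over [S]. *)
have [[t /leavitt_eqP/lrep_cong ct tS] _] := good_units (Sub _ ipP) (gen_s _).
have /= := ct (fun=> 1) 0%N; rewrite mulr1 => ->.
by apply: lrep_closed => // _; apply: rpred1.
Qed.

(** * Transvections and trees of words *)

Definition incomparable (T : eqType) (v w : seq T) := ~~ prefix v w && ~~ prefix w v.

Lemma incomparableC (T : eqType) (v w : seq T) : incomparable v w = incomparable w v.
Proof. by rewrite /incomparable andbC. Qed.

Lemma incomparable_cons (T : eqType) (i j : T) v w :
  incomparable (i :: v) (j :: w) = (i != j) || incomparable v w.
Proof. by rewrite /incomparable /= ![_ == j]eq_sym; case: eqVneq. Qed.

Lemma incomparable_size (T : eqType) (v w : seq T) :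
  size v = size w -> v != w -> incomparable v w.
Proof.
elim: v w => [|i v IHv] [|j w] //= [vw]; rewrite eqseq_cons negb_and.
rewrite incomparable_cons; by case: eqVneq => //= _; apply: IHv.
Qed.

(** Groups of units are handled as predicates on the ring, so that products and commutators can be
    computed there. *)
Definition subgroup_pred (A : pzRingType) (H : A -> Prop) :=
  [/\ H 1, forall x y, H x -> H y -> H (x * y)
    & forall x, H x -> exists y, [/\ x * y = 1, y * x = 1 & H y]].

(** From [y * x = 0] one gets [(1 + x) * (1 + y) = (1 + x * y) * ((1 + y) * (1 + x))], and [1 - x],
    [1 - y] are inverses because the squares vanish. *)
Lemma commutator_square_zero (A : pzRingType) (x y : A) :
  x * x = 0 -> y * y = 0 -> y * x = 0 ->
  (1 + x) * (1 + y) * ((1 - x) * (1 - y)) = 1 + x * y.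
Proof.
move=> xx yy yx.
have D u v : (1 + u) * (1 + v) = 1 + (u + v + u * v) :> A.
  by rewrite mulrDl mul1r mulrDr mulr1 -!addrA; congr (_ + _); rewrite addrCA.
have inv (u : A) : u * u = 0 -> (1 + u) * (1 - u) = 1.
  by move=> uu; rewrite D mulrN uu subrr oppr0 !addr0.
have -> : (1 + x) * (1 + y) = (1 + x * y) * ((1 + y) * (1 + x)).
  rewrite (D y) yx addr0 !D mulrDr -!mulrA yx yy !mulr0 !addr0.
  by rewrite [x * y + _]addrC (addrC y).
by rewrite -!mulrA (mulrA (1 + x)) inv // mul1r inv // mulr1.
Qed.

Section Isometries.
Context (K : fieldType) (n : nat) (A : algType K).
Local Notation d := n.+2.
Context (a b : 'I_d -> A).
Hypothesis star_gen : forall i j, b i * a j = (i == j)%:R.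
Hypothesis gen_star : \sum_i a i * b i = 1.

Definition wgen (w : seq 'I_d) : A := \prod_(i <- w) a i.
(** The word is reversed because the star reverses products. *)
Definition wstar (w : seq 'I_d) : A := \prod_(i <- rev w) b i.
Local Notation p := wgen.
Local Notation q := wstar.

Lemma wgen_cat v w : p (v ++ w) = p v * p w.
Proof. exact: big_cat. Qed.

Lemma wstar_cat v w : q (v ++ w) = q w * q v.
Proof. by rewrite /q rev_cat big_cat. Qed.

Lemma wgen1 i : p [:: i] = a i. Proof. exact: big_seq1. Qed.
Lemma wstar1 i : q [:: i] = b i. Proof. exact: big_seq1. Qed.

Lemma wgen_cons i w : p (i :: w) = a i * p w.
Proof. by rewrite -wgen1 -wgen_cat. Qed.

Lemma wstar_cons i w : q (i :: w) = q w * b i.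
Proof. by rewrite -wstar1 -wstar_cat. Qed.

Lemma wgen0 : p [::] = 1. Proof. exact: big_nil. Qed.
Lemma wstar0 : q [::] = 1. Proof. exact: big_nil. Qed.

Lemma wstar_genK w : q w * p w = 1.
Proof.
elim: w => [|i w IHw]; first by rewrite wgen0 wstar0 mulr1.
by rewrite wgen_cons wstar_cons mulrA -(mulrA (q w)) star_gen eqxx mulr1.
Qed.

Lemma wstar_gen_incomparable v w : incomparable v w -> q v * p w = 0.
Proof.
elim: v w => [|i v IHv] [|j w] //; rewrite incomparable_cons.
rewrite wgen_cons wstar_cons mulrA -(mulrA (q v)) star_gen.
by case: eqVneq => /= [_ /IHv|]; rewrite ?mulr1 ?mulr0 ?mul0r.
Qed.

Definition transvection v c w := 1 + p v * c * q w.

(** The cross term contains [q w * p v], which is 0. *)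
Lemma transvectionD v w c e : incomparable v w ->
  transvection v (c + e) w = transvection v c w * transvection v e w.
Proof.
move=> vw; rewrite /transvection [RHS]mulrDl mul1r [in RHS]mulrDr mulr1.
rewrite (mulrDr (p v)) mulrDl.
have -> : p v * c * q w * (p v * e * q w) = 0.
  rewrite -!mulrA (mulrA (q w)) wstar_gen_incomparable 1?incomparableC //.
  by rewrite mul0r !mulr0.
by rewrite addr0 -!addrA [p v * c * _ + _]addrC.
Qed.

(** * Generation by short transvections and dilations *)

Section Subgroup.
Variable H : A -> Prop.
Hypothesis Hgrp : subgroup_pred H.
Hypothesis H2 : forall v w c, size v = 2%N -> size w = 2%N -> v != w -> H (transvection v c w).
Hypothesis HD : forall i (c : K), c != 0 -> H (1 + (c - 1) *: (a i * b i)).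

Let H1 : H 1. Proof. by case: Hgrp. Qed.
Let HM x y : H x -> H y -> H (x * y). Proof. by case: Hgrp => _ + _; apply. Qed.

Lemma transvection_sum v w I (r : seq I) (P : pred I) (F : I -> A) : incomparable v w ->
  (forall i, P i -> H (transvection v (F i) w)) ->
  H (transvection v (\sum_(i <- r | P i) F i) w).
Proof.
move=> vw HF; elim/big_ind: _ => [|x y Hx Hy|//].
  by rewrite /transvection mulr0 mul0r addr0.
by rewrite transvectionD //; apply: HM.
Qed.

(** A commutator of two transvections that meet in [z]; opposite coefficients give the inverses. *)
Lemma transvection_trans v z w x y :
  incomparable v z -> incomparable z w -> incomparable v w ->
  H (transvection v x z) -> H (transvection v (- x) z) ->
  H (transvection z y w) -> H (transvection z (- y) w) ->
  H (transvection v (x * y) w).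
Proof.
move=> vz zw vw Hx HNx Hy HNy; have := HM (HM Hx Hy) (HM HNx HNy).
rewrite /transvection !mulrN !mulNr commutator_square_zero.
- by rewrite -!mulrA (mulrA (q z)) wstar_genK // mul1r.
- by rewrite -!mulrA (mulrA (q z)) wstar_gen_incomparable 1?incomparableC // mul0r !mulr0.
- by rewrite -!mulrA (mulrA (q w)) wstar_gen_incomparable 1?incomparableC // mul0r !mulr0.
- by rewrite -!mulrA (mulrA (q w)) wstar_gen_incomparable 1?incomparableC // mul0r !mulr0.
Qed.

(** Inserting [\sum_i a i * b i = 1] on both sides of [c] lengthens both words to length 2. *)
Lemma transvection_letters i j c : i != j -> H (transvection [:: i] c [:: j]).
Proof.
move=> ij.
have -> : c = \sum_k \sum_l a k * (b k * c * a l) * b l.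
  rewrite -[LHS]mul1r -gen_star mulr_suml; apply: eq_bigr => k _.
  rewrite -[LHS]mulr1 -gen_star mulr_sumr; apply: eq_bigr => l _.
  by rewrite !mulrA.
apply: transvection_sum => [|k _]; first by rewrite incomparable_cons ij.
apply: transvection_sum => [|l _]; first by rewrite incomparable_cons ij.
have := H2 (b k * c * a l) (erefl : size [:: i; k] = 2%N) (erefl : size [:: j; l] = 2%N).
rewrite eqseq_cons (negPf ij) => /(_ isT).
by rewrite /transvection !(wgen_cons _ [:: _], wstar_cons _ [:: _]) !wgen1 !wstar1 !mulrA.
Qed.

Lemma transvection_mem v c w : incomparable v w -> H (transvection v c w).
Proof.
case: v w => [|i v] [|j w] //.
(* With distinct first letters, the remaining letters are absorbed into the coefficient. *)
have letters i' j' v' w' e : i' != j' -> H (transvection (i' :: v') e (j' :: w')).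
  move=> ij; have := transvection_letters (p v' * e * q w') ij.
  by rewrite /transvection -(cat1s i' v') -(cat1s j' w') wgen_cat wstar_cat !mulrA.
rewrite incomparable_cons; have [<-{j} /= vw|ij _] := eqVneq i j; last exact: letters.
(* With equal first letters, another letter [l] serves as the intermediate word. *)
have [l il] : exists l, i != l.
  by exists (if i == 0 then 1 else 0); case: (eqVneq i 0) => // ->.
have [li ivl lw] : [/\ l != i, incomparable (i :: v) [:: l] & incomparable [:: l] (i :: w)].
  by rewrite !incomparable_cons il eq_sym il.
rewrite -[c]mulr1; apply: (transvection_trans ivl lw);
  by rewrite ?incomparable_cons ?eqxx //; apply: letters.
Qed.

Section Block.
Variables (v w : seq 'I_d).
Hypothesis vw : incomparable v w.

Let t (i : 'I_2) := if i == 0 then v else w.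

(** The [p (t i) * q (t j)] are matrix units; the 2 by 2 matrices act in their corner, with the
    identity on the complement. *)
Definition block (M : 'M[K]_2) : A := 1 + \sum_i \sum_j (M - 1) i j *: (p (t i) * q (t j)).

Lemma blockM M N : block M * block N = block (M * N).
Proof.
have starK i j : q (t i) * p (t j) = (i == j)%:R.
  rewrite /t; case: i j => [[|[|//]] ?] [[|[|//]] ?] /=;
    by rewrite ?wstar_genK // wstar_gen_incomparable // incomparableC.
pose X (M : 'M[K]_2) : A := \sum_i \sum_j M i j *: (p (t i) * q (t j)).
have XD (M1 M2 : 'M_2) : X (M1 + M2) = X M1 + X M2.
  rewrite -big_split; apply: eq_bigr => i _; rewrite -big_split; apply: eq_bigr => j _.
  by rewrite mxE scalerDl.
have XM (M1 M2 : 'M_2) : X M1 * X M2 = X (M1 * M2).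
  rewrite /X mulr_suml; apply: eq_bigr => i _.
  rewrite mulr_suml (eq_bigr (fun k => \sum_j (M1 i k * M2 k j) *: (p (t i) * q (t j)))).
    rewrite exchange_big; apply: eq_bigr => j _.
    by rewrite mxE scaler_suml.
  move=> k _; rewrite mulr_sumr (bigD1 k) //= [X in _ + X]big1 => [|l lk].
    rewrite addr0 mulr_sumr; apply: eq_bigr => j _.
    by rewrite -scalerAl -scalerAr scalerA -!mulrA (mulrA (q (t k))) starK eqxx mul1r.
  rewrite mulr_sumr big1 // => j _.
  rewrite -scalerAl -scalerAr -!mulrA (mulrA (q (t k))) starK eq_sym (negPf lk).
  by rewrite mul0r mulr0 !scaler0.
rewrite /block -!/(X _) mulrDl mul1r mulrDr mulr1 XM -addrA -!XD; congr (1 + X _).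
by rewrite -[X in _ + (X + _)]mulr1 -mulrDr addrCA subrr addr0 mulrBl mul1r addrC subrKA.
Qed.

Definition mx2 (x y z u : K) : 'M[K]_2 :=
  \matrix_(i, j) if i == 0 then if j == 0 then x else y else if j == 0 then z else u.

Lemma mul_mx2 x y z u x' y' z' u' :
  mx2 x y z u * mx2 x' y' z' u' =
  mx2 (x * x' + y * z') (x * y' + y * u') (z * x' + u * z') (z * y' + u * u').
Proof.
apply/matrixP => i j; rewrite !mxE !big_ord_recl big_ord0 !mxE /= addr0.
by case: i j => [[|[|//]] ?] [[|[|//]] ?].
Qed.

Lemma block_mx2 x y z u : block (mx2 x y z u) =
  1 + ((x - 1) *: (p v * q v) + y *: (p v * q w)
       + (z *: (p w * q v) + (u - 1) *: (p w * q w))).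
Proof.
by rewrite /block !big_ord_recl !big_ord0 !mxE /= !addr0 !subr0.
Qed.

Lemma block_upper y : H (block (mx2 1 y 0 1)).
Proof.
rewrite block_mx2 subrr !scale0r !addr0 add0r.
have := transvection_mem y%:A vw; rewrite /transvection.
by rewrite -scalerAr mulr1 scalerAl.
Qed.

Lemma block_lower z : H (block (mx2 1 0 z 1)).
Proof.
rewrite block_mx2 subrr !scale0r !addr0 add0r.
have wv : incomparable w v by rewrite incomparableC.
have := transvection_mem z%:A wv; rewrite /transvection.
by rewrite -scalerAr mulr1 scalerAl.
Qed.

(** The product upper, lower, upper of elementary matrices familiar from [SL_2]; two such rotations
    then give the diagonal torus. *)
Lemma block_rotation c : c != 0 -> H (block (mx2 0 c (- c^-1) 0)).
Proof.
move=> c0; have := HM (HM (block_upper c) (block_lower (- c^-1))) (block_upper c).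
rewrite !blockM !mul_mx2; congr (H (block (mx2 _ _ _ _))); by field.
Qed.

Lemma block_torus c : c != 0 -> H (block (mx2 c 0 0 c^-1)).
Proof.
move=> c0; have N1 : (-1 : K) != 0 by rewrite oppr_eq0 oner_eq0.
have := HM (block_rotation c0) (block_rotation N1).
rewrite blockM mul_mx2 invrN1 opprK.
by rewrite !(mul0r, mulr0, mulr1, mulrN1, add0r, addr0, opprK, oppr0).
Qed.

End Block.

Definition dilation v (c : K) := 1 + (c - 1) *: (p v * q v).

(** The torus element for the word and a letter [l] other than its first has [c^-1] at [l]; the
    given dilation at [l] cancels it. *)
Lemma dilation_mem v c : v != [::] -> c != 0 -> H (dilation v c).
Proof.
case: v => // i v _ c0.
have [l il] : exists l, i != l.
  by exists (if i == 0 then 1 else 0); case: (eqVneq i 0) => // ->.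
have vl : incomparable (i :: v) [:: l] by rewrite incomparable_cons il.
have := HM (block_torus vl c0) (HD l c0).
have -> : 1 + (c - 1) *: (a l * b l) = block (i :: v) [:: l] (mx2 1 0 0 c).
  by rewrite block_mx2 subrr !scale0r !add0r wgen1 wstar1.
rewrite blockM // mul_mx2 block_mx2 /dilation; congr (H (1 + _)).
by rewrite !(mulr0, mul0r, addr0, add0r, mulr1) mulVf // subrr !scale0r !addr0.
Qed.

Definition swap v w := block v w (mx2 0 1 1 0).

Lemma swap_mem v w : incomparable v w -> H (swap v w).
Proof.
move=> vw; have v0 : v != [::] by apply: contraTneq vw => ->; rewrite /incomparable prefix0s.
have N1 : (-1 : K) != 0 by rewrite oppr_eq0 oner_eq0.
have := HM (block_rotation vw (oner_neq0 K)) (dilation_mem v0 N1).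
have -> : dilation v (-1) = block v w (mx2 (-1) 0 0 1).
  by rewrite block_mx2 subrr !scale0r !addr0.
rewrite blockM // mul_mx2 invr1.
by rewrite !(mul0r, mulr0, mul1r, mulr1, mulrN1, add0r, addr0, opprK, oppr0).
Qed.

Lemma wstar_swap v w z : incomparable v w ->
  (z = v \/ z = w \/ incomparable z v /\ incomparable z w) ->
  q z * swap v w = q (if z == v then w else if z == w then v else z).
Proof.
move=> vw; have wv : incomparable w v by rewrite incomparableC.
have vw0 : (w == v) = false by apply: contraTF wv => /eqP->; rewrite /incomparable prefix_refl.
rewrite /swap block_mx2 !sub0r !scaleN1r !scale1r mulrDr mulr1 !mulrDr !mulrN !mulrA.
case=> [->|[->|[zv zw]]].
- rewrite eqxx wstar_genK !(wstar_gen_incomparable vw) !mul0r !mul1r oppr0 !addr0.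
  by rewrite addrA subrr add0r.
- rewrite vw0 eqxx wstar_genK !(wstar_gen_incomparable wv) !mul0r !mul1r oppr0 !add0r.
  by rewrite addrCA subrr addr0.
rewrite !(wstar_gen_incomparable zv) !(wstar_gen_incomparable zw) !mul0r oppr0 !addr0.
have zE u : incomparable z u -> (z == u) = false.
  by apply: contraTF => /eqP->; rewrite /incomparable prefix_refl.
by rewrite !zE.
Qed.

End Subgroup.

(** * Complete prefix codes and the Higman-Thompson group *)

Inductive tree : seq (seq 'I_d) -> Prop :=
| tree_root : tree [:: [::]]
| tree_perm s t : perm_eq s t -> tree s -> tree t
| tree_expand v s : tree (v :: s) -> tree ([seq rcons v i | i <- enum 'I_d] ++ s).

Lemma tree_uniq s : tree s -> uniq s /\ {in s &, forall v w, prefix v w -> v = w}.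
Proof.
elim=> {s} [|s t st _ [us sP]|v s _ [/= /andP[vs us] sP]].
- by split=> // v w; rewrite !inE => /eqP-> /eqP->.
- rewrite -(perm_uniq st); split=> // v w vt wt.
  by apply: sP; rewrite (perm_mem st).
have sz i : size (rcons v i) = (size v).+1 by rewrite size_rcons.
have vS w : w \in s -> ~~ prefix v w.
  move=> ws; apply: contraNN vs => vw.
  by rewrite (sP v w) ?inE ?eqxx ?ws ?orbT.
have Sv w : w \in s -> ~~ prefix w v.
  move=> ws; apply: contraNN vs => wv.
  by rewrite -(sP w v) ?inE ?eqxx ?ws ?orbT.
have r_inj : injective (rcons v) by move=> i j; apply: rcons_injr.
split.
  rewrite cat_uniq us map_inj_uniq // enum_uniq /= andbT.
  apply/hasPn => w ws; apply/mapP => -[i _ def_w].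
  by have := vS w ws; rewrite def_w prefix_rcons.
move=> w z; rewrite !mem_cat => /orP[/mapP[i _ ->]|ws] /orP[/mapP[j _ ->]|zs].
- by rewrite prefixE !sz -(sz j) take_size => /eqP.
- by move/(prefix_trans (prefix_rcons v i)); rewrite (negPf (vS z zs)).
- rewrite prefixE => /eqP wz; have [lt_w|le_w] := ltnP (size v) (size w).
    by rewrite -wz take_oversize // sz.
  by have := Sv w ws; rewrite prefixE -(takel_cat [:: j]) // cats1 wz eqxx.
by apply: sP; rewrite inE ?ws ?zs orbT.
Qed.

Lemma tree_incomparable s v w : tree s -> v \in s -> w \in s -> v != w -> incomparable v w.
Proof.
move=> /tree_uniq[_ sP] vs ws vw; apply/andP; split; apply: contraNN vw => pf.
  by rewrite (sP v w).
by rewrite (sP w v).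
Qed.

Lemma rcons_sum v : \sum_i p (rcons v i) * q (rcons v i) = p v * q v.
Proof.
rewrite -[p v]mulr1 -gen_star mulr_sumr mulr_suml; apply: eq_bigr => i _.
by rewrite -cats1 wgen_cat wstar_cat wgen1 wstar1 !mulrA.
Qed.

Lemma tree_sum s : tree s -> \sum_(v <- s) p v * q v = 1.
Proof.
elim=> {s} [|s t st _ <-|v s _]; first by rewrite big_seq1 wgen0 wstar0 mulr1.
  by apply: perm_big; rewrite perm_sym.
by rewrite big_cons big_cat big_map big_enum /= rcons_sum.
Qed.

(** Permutations may follow an expansion, so plain inversion would not display [d] sibling leaves;
    this form does, up to order. *)
Lemma tree_inv t : tree t ->
  t = [:: [::]] \/
  exists v s, tree (v :: s) /\ perm_eq ([seq rcons v i | i <- enum 'I_d] ++ s) t.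
Proof.
elim=> {t} [|s t st _ [def_s|[v [s' [vs' s's]]]]|v s vs _]; first by left.
- left; have := perm_size st; rewrite def_s => /esym.
  by case: t st => [|w [|? ?]] // + _; rewrite def_s perm_sym => /perm_small_eq->.
- by right; exists v, s'; split=> //; apply: perm_trans s's st.
by right; exists v, s.
Qed.

(** For trees of equal size, the element of the Higman-Thompson group that carries each leaf of [t]
    to the leaf of [s] at the same place. *)
Definition pairing (s t : seq (seq 'I_d)) : A := \sum_(x <- zip s t) p x.1 * q x.2.

Lemma pairing_id s : tree s -> pairing s s = 1.
Proof.
move/tree_sum <-; rewrite /pairing.
by elim: s => [|v s IHs]; rewrite ?big_nil //= !big_cons IHs.
Qed.

(** Paired leaves may be expanded together, because [\sum_i a i * b i = 1]. *)
Lemma pairing_expand v s w t :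
  pairing ([seq rcons v i | i <- enum 'I_d] ++ s) ([seq rcons w i | i <- enum 'I_d] ++ t)
  = pairing (v :: s) (w :: t).
Proof.
rewrite /pairing zip_cat ?size_map // big_cat /= big_cons; congr (_ + _).
have -> : zip [seq rcons v i | i <- enum 'I_d] [seq rcons w i | i <- enum 'I_d]
    = [seq (rcons v i, rcons w i) | i <- enum 'I_d] by elim: (enum _) => //= ? ? ->.
rewrite big_map big_enum /= -[p v]mulr1 -gen_star mulr_sumr mulr_suml.
by apply: eq_bigr => i _; rewrite -!cats1 wgen_cat wstar_cat wgen1 wstar1 !mulrA.
Qed.

Lemma wstar_gen_tree t v w : tree t -> v \in t -> w \in t -> q v * p w = (v == w)%:R.
Proof.
move=> Tt vt wt; have [<-|vw] := eqVneq; first exact: wstar_genK.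
exact/wstar_gen_incomparable/(tree_incomparable Tt).
Qed.

Lemma pairing_trans s t r : tree t -> size s = size t -> size t = size r ->
  pairing s t * pairing t r = pairing s r.
Proof.
move=> Tt st tr; rewrite /pairing !(big_nth ([::], [::])) !size_zip st -tr minnn.
rewrite mulr_suml [LHS]big_nat [RHS]big_nat; apply: eq_bigr => i /andP[_ it].
rewrite mulr_sumr (bigD1_seq i) ?mem_index_iota ?iota_uniq //= big_nat_cond [X in _ + X]big1.
  rewrite addr0 !nth_zip -?tr //= -!mulrA (mulrA (q _)).
  by rewrite (wstar_gen_tree Tt) ?mem_nth // eqxx mul1r.
move=> j /andP[/andP[_ jt] ji]; rewrite !nth_zip -?tr //= -!mulrA (mulrA (q _)).
rewrite (wstar_gen_tree Tt) ?mem_nth // nth_uniq //; last by case: (tree_uniq Tt).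
by rewrite eq_sym (negPf ji) mul0r mulr0.
Qed.

Lemma pairing_perm s s' t : perm_eq s s' -> size s' = size t ->
  exists2 t', perm_eq t t' & pairing s' t = pairing s t'.
Proof.
move=> /(perm_iotaP [::])[Is Isp ->] s't.
exists [seq nth [::] t i | i <- Is].
  by rewrite perm_sym; apply/(perm_iotaP [::]); exists Is; rewrite // -s't.
rewrite /pairing zip_map big_map /= (perm_big _ Isp).
rewrite (big_nth ([::], [::])) size_zip -s't minnn /index_iota subn0 /=.
by apply: eq_bigr => i _; rewrite nth_zip.
Qed.

Section SubgroupPairing.
Variable H : A -> Prop.
Hypothesis Hgrp : subgroup_pred H.
Hypothesis H2 : forall v w c, size v = 2%N -> size w = 2%N -> v != w -> H (transvection v c w).
Hypothesis HD : forall i (c : K), c != 0 -> H (1 + (c - 1) *: (a i * b i)).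

Let HM x y : H x -> H y -> H (x * y). Proof. by case: Hgrp => _ + _; apply. Qed.

Definition transpose (e f z : seq 'I_d) := if z == e then f else if z == f then e else z.

Lemma transposeK e f : involutive (transpose e f).
Proof.
move=> z; rewrite /transpose; have [->|ze] := eqVneq z e.
  by rewrite eqxx; case: eqVneq.
have [->|zf] := eqVneq z f; first by rewrite eqxx.
by rewrite (negPf ze) (negPf zf).
Qed.

Lemma pairing_swap t s r e f : tree t -> e \in t -> f \in t -> e != f ->
  {subset r <= t} -> pairing s r * swap e f = pairing s (map (transpose e f) r).
Proof.
move=> Tt et ft ef; rewrite /pairing.
elim: s r => [|v s IHs] [|w r] rt; rewrite ?big_nil ?mul0r //=.
rewrite !big_cons mulrDl IHs => [|z zr]; last by rewrite rt // inE zr orbT.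
have wt : w \in t by rewrite rt // inE eqxx.
congr (_ + _); rewrite /= -mulrA wstar_swap //; first exact: (tree_incomparable Tt).
have [->|we] := eqVneq w e; first by left.
have [->|wf] := eqVneq w f; first by right; left.
by right; right; split; apply: (tree_incomparable Tt).
Qed.

Lemma swapK v w : incomparable v w -> swap v w * swap v w = 1.
Proof.
move=> vw; rewrite /swap blockM // mul_mx2 block_mx2 /=.
by rewrite !(mul0r, mulr0, mulr1, add0r, addr0) subrr !scale0r !addr0.
Qed.

(** A permutation of the leaves is sorted by transpositions, each of them a [swap]. *)
Lemma pairing_perm_mem t t' : tree t -> perm_eq t t' -> H (pairing t t').
Proof.
(* The list [r] collects the leaves that are already in place. *)
suff gen x r y : tree (r ++ x) -> perm_eq x y -> H (pairing (r ++ x) (r ++ y)).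
  by move=> Tt tt'; have := gen t [::] t' Tt tt'.
elim: x r y => [|e x IHx] r y Tx xy.
  by move: xy; rewrite perm_sym => /perm_nilP->; rewrite pairing_id //; case: Hgrp.
case: y xy => [/perm_size//|f y] xy.
have [ef|ef] := eqVneq e f.
  move: xy; rewrite -{f}ef perm_cons => xy.
  by rewrite -!cat_rcons; apply: IHx; rewrite ?cat_rcons.
have [ux _] := tree_uniq Tx; move: (ux); rewrite cat_uniq => /and3P[_ /hasPn rx uex].
have uy : uniq (f :: y) by rewrite -(perm_uniq xy).
have fx : f \in e :: x by rewrite (perm_mem xy) inE eqxx.
have eT : e \in r ++ e :: x by rewrite mem_cat inE eqxx orbT.
have fT : f \in r ++ e :: x by rewrite mem_cat fx orbT.
have iT : incomparable e f by apply: (tree_incomparable Tx).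
have sub_y : {subset r ++ f :: y <= r ++ e :: x}.
  by move=> z; rewrite !mem_cat (perm_mem xy).
(* The swap brings [e] opposite itself, which shortens the unsorted part. *)
have -> : pairing (r ++ e :: x) (r ++ f :: y) =
    pairing (r ++ e :: x) (map (transpose e f) (r ++ f :: y)) * swap e f.
  by rewrite -(pairing_swap _ Tx) // -mulrA swapK // mulr1.
apply: HM; last exact: swap_mem.
have -> : map (transpose e f) (r ++ f :: y) = r ++ e :: map (transpose e f) y.
  rewrite map_cat /= {2}/transpose eqxx eq_sym (negPf ef); congr (_ ++ _).
  rewrite -[RHS]map_id; apply/eq_in_map => z zr; rewrite /transpose.
  have /negPf-> : z != e by apply: contraTneq zr => ->; apply: rx; rewrite inE eqxx.
  by have /negPf-> : z != f by apply: contraTneq zr => ->; apply: rx.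
rewrite -!cat_rcons; apply: IHx; rewrite ?cat_rcons //.
case/andP: uex => ex ux'; case/andP: uy => fy uy'.
apply: uniq_perm => // [|z]; first by rewrite map_inj_uniq //; apply/inv_inj/transposeK.
rewrite -{2}[z](transposeK e f) (mem_map (inv_inj (transposeK e f))).
have memx u : (u \in x) = (u != e) && (u \in e :: x).
  by rewrite inE; have [->|] := eqVneq u e; rewrite ?(negPf ex).
have memy u : (u \in y) = (u != f) && (u \in e :: x).
  by rewrite (perm_mem xy) inE; have [->|] := eqVneq u f; rewrite ?(negPf fy).
rewrite memx memy /transpose; have [->|ze] := eqVneq z e; first by rewrite eqxx.
have fe : (f == e) = false by rewrite eq_sym (negPf ef).
have [->|zf] := eqVneq z f; first by rewrite ?eqxx ?fe fx inE eqxx ef.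
by rewrite zf.
Qed.

(** A permutation of the leaves of [t] puts [d] siblings opposite the [d] siblings last created in
    [s]; both families are then contracted together. *)
Lemma pairing_mem s t : tree s -> tree t -> size s = size t -> H (pairing s t).
Proof.
move=> Ts; elim: {s} Ts t => [|s s' ss' _ IHs|v s _ IHs] t Tt st.
- have [->|[v [s [_ /perm_size]]]] := tree_inv Tt.
    by rewrite pairing_id; [case: Hgrp|exact: tree_root].
  by rewrite -st size_cat size_map size_enum_ord.
- have [t' tt' ->] := pairing_perm ss' st.
  by apply: IHs; [exact: tree_perm tt' Tt|rewrite (perm_size ss') st (perm_size tt')].
have [def_t|[w [t0 [Tw wt]]]] := tree_inv Tt.
  by move: st; rewrite def_t size_cat size_map size_enum_ord.
have Tt0 := tree_expand Tw.
rewrite -(pairing_trans Tt0) ?(perm_size wt) //.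
apply: HM; last exact: pairing_perm_mem.
rewrite pairing_expand; apply: IHs => //.
by move: st; rewrite -(perm_size wt) !size_cat !size_map /= => /addnI->.
Qed.

End SubgroupPairing.
End Isometries.

(** * Leading words and bases of right ideals *)

Lemma incomparable_cat (T : eqType) (v w x y : seq T) :
  incomparable v w -> v ++ x != w ++ y.
Proof.
elim: v w => [|i v IHv] [|j w] //; rewrite incomparable_cons /= eqseq_cons negb_and.
by case: eqVneq => //= _; apply: IHv.
Qed.

Lemma incomparable_catl (T : eqType) (v w x : seq T) :
  incomparable v w -> incomparable (v ++ x) w.
Proof.
elim: v w => [|i v IHv] [|j w] //; rewrite /= !incomparable_cons.
by case: eqVneq => //= _; apply: IHv.
Qed.

(** * A monomial order on words *)

Section WordOrder.
Variable n : nat.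
Local Notation d := n.+2.
Implicit Types v w z : seq 'I_d.

(** Base [d] digits, first letter least significant, with a leading 1. A new first letter acts as in
    [lrep], so [p w] takes the indicator of 1 to that of [num w]; the induced order compares lengths
    first. *)
Definition num w : nat := foldr (fun (i : 'I_d) k => d * k + i)%N 1%N w.

Lemma num_cat v w : (num (v ++ w) + d ^ size v = d ^ size v * num w + num v)%N.
Proof.
elim: v => [|i v IHv] /=; first by rewrite expn0 mul1n.
rewrite expnS; move: IHv; set x := num (v ++ w); set y := (d ^ size v)%N => IHv.
by rewrite addnAC -mulnDr IHv mulnDr mulnA addnA.
Qed.

Lemma num_bounds w : (d ^ size w <= num w < 2 * d ^ size w)%N.
Proof.
elim: w => [|i w IHw] //=; rewrite expnS; have := ltn_ord i.
set x := num w in IHw *; set y := (d ^ size w)%N in IHw *; nia.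
Qed.

Lemma num_gt0 w : (0 < num w)%N.
Proof. by have /andP[+ _] := num_bounds w; apply: leq_trans; rewrite expn_gt0. Qed.

(** Words of length [m] have numbers from [d ^ m] up to [2 * d ^ m], excluded; as [2 <= d], these
    intervals follow one another. *)
Lemma leq_num_size v w : (num v <= num w)%N -> (size v <= size w)%N.
Proof.
move=> vw; rewrite leqNgt; apply/negP => wv.
have /andP[v1 _] := num_bounds v; have /andP[_ w2] := num_bounds w.
have : (d ^ (size w).+1 <= d ^ size v)%N by rewrite leq_exp2l.
rewrite expnS; move: (d ^ size v)%N v1 (d ^ size w)%N w2 => x v1 y w2; nia.
Qed.

Lemma num_inj : injective num.
Proof.
elim=> [|i v IHv] [|j w] //=; first by have := num_gt0 w; nia.
  by have := num_gt0 v; nia.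
move=> e; have ij : i = j.
  by apply/val_inj; have := congr1 (modn^~ d) e; rewrite !(mulnC d) !modnMDl !modn_small.
by rewrite ij (IHv w) //; move: e; rewrite ij; nia.
Qed.

Lemma ltn_num_catl z v w : (num v < num w)%N -> (num (z ++ v) < num (z ++ w))%N.
Proof. by elim: z => //= i z IHz /IHz; rewrite ltn_add2r ltn_pmul2l. Qed.

Lemma ltn_num_catr z v w : (num v < num w)%N -> (num (v ++ z) < num (w ++ z))%N.
Proof.
move=> vw; have := num_cat v z; have := num_cat w z; have := num_gt0 z.
have /andP[v1 v2] := num_bounds v; have /andP[w1 w2] := num_bounds w.
have := leq_num_size (ltnW vw); rewrite leq_eqVlt => /predU1P[->|lt_vw].
  by move: (d ^ size w)%N => y; lia.
(* For [v] shorter than [w]: [num (v ++ z) < 2 * d ^ size v * num z <= d ^ size w * num z <= num (w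
   ++ z)]. *)
have : (d ^ (size v).+1 <= d ^ size w)%N by rewrite leq_exp2l.
rewrite expnS; move: (d ^ size v)%N v1 v2 (d ^ size w)%N w1 w2 => x v1 v2 y w1 w2 xy.
move=> z0 Ew Ev; have yx : (2 * x <= y)%N by apply: leq_trans xy; rewrite leq_mul2r orbT.
have := leq_mul yx (leqnn (num z)); have := leq_mul (leqnn x) z0; lia.
Qed.

End WordOrder.

Section Words.
Variable n : nat.
Local Notation d := n.+2.

Fixpoint words (m : nat) : seq (seq 'I_d) :=
  if m is m'.+1 then flatten [seq [seq rcons v i | i <- enum 'I_d] | v <- words m']
  else [:: [::]].

Lemma mem_words m w : (w \in words m) = (size w == m).
Proof.
elim: m w => [|m IHm] w /=; first by rewrite inE; case: w.
apply/flatten_mapP/idP => [[v]|].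
  by rewrite IHm => /eqP <- /mapP[i _ ->]; rewrite size_rcons.
case/lastP: w => // v i; rewrite size_rcons eqSS -IHm => vm.
by exists v => //; rewrite map_f ?mem_enum.
Qed.

Lemma tree_expand_all s t : tree (s ++ t) ->
  tree (flatten [seq [seq rcons v i | i <- enum 'I_d] | v <- s] ++ t).
Proof.
elim: s t => //= v s IHs t /tree_expand Tvst.
rewrite -catA; apply: tree_perm (permEl (perm_catCA _ _ _)) _; apply: IHs.
exact: tree_perm (permEl (perm_catCA _ _ _)) Tvst.
Qed.

Lemma words_tree m : tree (words m).
Proof.
elim: m => [|m IHm]; first exact: tree_root.
by rewrite /= -[flatten _]cats0; apply: tree_expand_all; rewrite cats0.
Qed.

End Words.

(** * Polynomials in the words *)

Section Polynomials.
Context (K : fieldType) (n : nat) (A : algType K).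
Local Notation d := n.+2.
Context (a b : 'I_d -> A).
Hypothesis star_gen : forall i j, b i * a j = (i == j)%:R.
Hypothesis gen_star : \sum_i a i * b i = 1.
Local Notation p := (wgen a).
Local Notation q := (wstar b).
(** Functionals dual to the words, defined on all of [A]; they witness the linear independence of
    the [p w]. *)
Variable coef : seq 'I_d -> A -> K.
Hypothesis coefD : forall w x y, coef w (x + y) = coef w x + coef w y.
Hypothesis coefZ : forall w c x, coef w (c *: x) = c * coef w x.
Hypothesis coef_gen : forall w v, coef w (p v) = (v == w)%:R.
Implicit Types (x y : A) (v w z : seq 'I_d).

Lemma coef0 w : coef w 0 = 0.
Proof. by rewrite -(scale0r 0) coefZ mul0r. Qed.

Lemma coef_sum w I (r : seq I) (F : I -> A) :
  coef w (\sum_(i <- r) F i) = \sum_(i <- r) coef w (F i).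
Proof. exact: (big_morph _ (coefD w) (coef0 w)). Qed.

Lemma coefB w x y : coef w (x - y) = coef w x - coef w y.
Proof. by rewrite -scaleN1r coefD coefZ mulN1r. Qed.

Definition wpoly x : Prop :=
  exists s : seq (K * seq 'I_d), x = \sum_(t <- s) t.1 *: p t.2.

Lemma wpoly0 : wpoly 0. Proof. by exists [::]; rewrite big_nil. Qed.

Lemma wpolyG w : wpoly (p w).
Proof. by exists [:: (1, w)]; rewrite big_seq1 scale1r. Qed.

Lemma wpolyD x y : wpoly x -> wpoly y -> wpoly (x + y).
Proof. by move=> [s ->] [t ->]; exists (s ++ t); rewrite big_cat. Qed.

Lemma wpolyZ c x : wpoly x -> wpoly (c *: x).
Proof.
move=> [s ->]; exists [seq (c * t.1, t.2) | t <- s].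
by rewrite big_map scaler_sumr; apply: eq_bigr => t _; rewrite scalerA.
Qed.

Lemma wpolyB x y : wpoly x -> wpoly y -> wpoly (x - y).
Proof. by move=> px py; rewrite -scaleN1r; apply/wpolyD/wpolyZ. Qed.

Lemma wpoly_sum I (r : seq I) (F : I -> A) :
  (forall i, wpoly (F i)) -> wpoly (\sum_(i <- r) F i).
Proof. by move=> pF; elim/big_ind: _ => //; [exact: wpoly0|exact: wpolyD]. Qed.

Lemma wpolyM x y : wpoly x -> wpoly y -> wpoly (x * y).
Proof.
move=> [s ->] [t ->]; rewrite mulr_suml; apply: wpoly_sum => v.
rewrite mulr_sumr; apply: wpoly_sum => w.
by rewrite -scalerAl -scalerAr -wgen_cat; do 2 apply: wpolyZ; apply: wpolyG.
Qed.

Lemma wpoly_coef x : wpoly x ->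
  exists2 s : seq (seq 'I_d), uniq s & x = \sum_(w <- s) coef w x *: p w.
Proof.
move=> [r ->]; exists (undup [seq t.2 | t <- r]); rewrite ?undup_uniq //.
under [RHS]eq_bigr => w _ do rewrite coef_sum scaler_suml.
rewrite exchange_big /= !big_seq; apply: eq_bigr => t tr.
rewrite (bigD1_seq t.2) ?undup_uniq //= ?mem_undup ?map_f //.
rewrite coefZ coef_gen eqxx mulr1 big1 ?addr0 // => w wt.
by rewrite coefZ coef_gen eq_sym (negPf wt) mulr0 scale0r.
Qed.

Lemma wpoly_neq0 x : wpoly x -> x != 0 -> exists w, coef w x != 0.
Proof.
move=> /wpoly_coef[s _ xE] x0; apply: contrapT => no; case/negP: x0; rewrite xE.
rewrite big1 // => w _; have [->|cw] := eqVneq (coef w x) 0; first exact: scale0r.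
by case: no; exists w.
Qed.

Lemma mem_support (r : seq (seq 'I_d)) z x :
  x = \sum_(w <- r) coef w x *: p w -> coef z x != 0 -> z \in r.
Proof.
move=> xE; apply: contraTT => zr; rewrite negbK xE coef_sum big_seq big1 // => u ur.
rewrite coefZ coef_gen; have [uz|] := eqVneq u z; last by rewrite mulr0.
by rewrite -uz ur in zr.
Qed.

Lemma coefM_neq0 u x y : wpoly x -> wpoly y -> coef u (x * y) != 0 ->
  exists v w, [/\ u = v ++ w, coef v x != 0 & coef w y != 0].
Proof.
move=> /wpoly_coef[s _ xE] /wpoly_coef[t _ yE] cu; apply: contrapT => no; case/negP: cu.
rewrite xE yE mulr_suml coef_sum big1 // => v _; rewrite mulr_sumr coef_sum big1 // => w _.
rewrite -scalerAl -scalerAr -wgen_cat !coefZ coef_gen -/(coef v x).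
have [uE|] := eqVneq (v ++ w) u; last by rewrite !mulr0.
have [->|cv] := eqVneq (coef v x) 0; first by rewrite mul0r.
have [->|cw] := eqVneq (coef w y) 0; first by rewrite mul0r mulr0.
by case: no; exists v, w.
Qed.

Lemma transvection_genE v c w : transvection a b v c w * p w = p w + p v * c.
Proof. by rewrite mulrDl mul1r -!mulrA wstar_genK // mulr1. Qed.

Lemma transvection_gen v c w z : incomparable w z -> transvection a b v c w * p z = p z.
Proof.
by move=> wz; rewrite mulrDl mul1r -!mulrA (wstar_gen_incomparable star_gen wz) !mulr0 addr0.
Qed.

Lemma wstar_transvectionE v c w : q v * transvection a b v c w = q v + c * q w.
Proof. by rewrite mulrDr mulr1 !mulrA wstar_genK // mul1r. Qed.

Lemma wstar_transvection v c w z : incomparable z v -> q z * transvection a b v c w = q z.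
Proof.
by move=> zv; rewrite mulrDr mulr1 !mulrA (wstar_gen_incomparable star_gen zv) !mul0r addr0.
Qed.

Lemma transvectionN v c w : incomparable v w ->
  transvection a b v c w * transvection a b v (- c) w = 1.
Proof.
by move=> vw; rewrite -(transvectionD star_gen c (- c) vw) subrr /transvection mulr0 mul0r addr0.
Qed.

(* The elements [u * p v] ([v \in T]) are a free basis of a right ideal of the algebra [F]
   spanned by the [p w]; this ideal lies in the [k]-th power of the augmentation ideal
   and contains the [m]-th one. *)
Definition ideal_basis (m k : nat) (T : seq (seq 'I_d)) (u u' : A) :=
  [/\ u * u' = 1, u' * u = 1, {in T, forall v, wpoly (u * p v)},
      {in T, forall v w, size w = m -> wpoly (q v * u' * p w)}
    & {in T, forall v z, coef z (u * p v) != 0 -> (k <= size z)%N}].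

(** * Leading words for an abstract monomial order *)

Section Lead.
Variable lt : rel (seq 'I_d).
Hypothesis lt_irr : irreflexive lt.
Hypothesis lt_trans : transitive lt.
Hypothesis lt_total : forall v w, v != w -> lt v w || lt w v.
Hypothesis lt_catl : forall z v w, lt v w -> lt (z ++ v) (z ++ w).
Hypothesis lt_catr : forall z v w, lt v w -> lt (v ++ z) (w ++ z).

Definition lead x w :=
  coef w x != 0 /\ forall v, coef v x != 0 -> v = w \/ lt v w.

Lemma lead_uniq x v w : lead x v -> lead x w -> v = w.
Proof.
move=> [v0 vP] [w0 wP]; have [//|vw] := vP w w0; have [//|wv] := wP v v0.
by have := lt_irr v; rewrite (lt_trans wv vw).
Qed.

Lemma lead_exists x : wpoly x -> x != 0 -> exists w, lead x w.
Proof.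
move=> px /(wpoly_neq0 px)[w0 cw0]; have [s _ xE] := wpoly_coef px.
suff [w [ws cw wP]] : exists w, [/\ w \in s, coef w x != 0 &
    forall v, v \in s -> coef v x != 0 -> v = w \/ lt v w].
  by exists w; split=> // v cv; apply: wP => //; apply: mem_support cv.
have: exists2 w, w \in s & coef w x != 0 by exists w0 => //; apply: mem_support cw0.
elim: (s) => [[w]|v t IHt ex] //; have [/IHt[w [wt cw wP]]|no] :=
    pselect (exists2 w, w \in t & coef w x != 0).
  have [[cv wv]|nvw] := pselect (coef v x != 0 /\ lt w v).
    exists v; split; rewrite ?inE ?eqxx // => z.
    rewrite inE => /predU1P[->|zt cz]; first by left.
    by right; have [->//|zw] := wP z zt cz; apply: lt_trans zw wv.
  exists w; split; rewrite ?inE ?wt ?orbT // => z.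
  rewrite inE => /predU1P[->|zt cz]; last exact: wP.
  have [->|vw] := eqVneq v w; first by left.
  by move=> cv; right; case/orP: (lt_total vw) => // wv; case: nvw.
have [cv|cv] := eqVneq (coef v x) 0; last first.
  exists v; split; rewrite ?inE ?eqxx // => z.
  by rewrite inE => /predU1P[->|zt cz]; [left|case: no; exists z].
case: ex => w; rewrite inE => /predU1P[->|wt cw]; first by rewrite cv eqxx.
by case: no; exists w.
Qed.

Lemma leadM x y v w : wpoly x -> wpoly y -> lead x v -> lead y w -> lead (x * y) (v ++ w).
Proof.
move=> px py [cv vP] [cw wP].
have le v' w' : coef v' x != 0 -> coef w' y != 0 ->
    v' = v /\ w' = w \/ lt (v' ++ w') (v ++ w).
  move=> /vP[->|lv] /wP[->|lw]; [by left|right|right|right].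
  - exact: lt_catl.
  - exact: lt_catr.
  - exact: lt_trans (lt_catr _ lv) (lt_catl _ lw).
split=> [|u /(coefM_neq0 px py)[v' [w' [-> cv' cw']]]]; last first.
  by have [[-> ->]|] := le _ _ cv' cw'; [left|right].
have [s us xE] := wpoly_coef px; have [t ut yE] := wpoly_coef py.
suff -> : coef (v ++ w) (x * y) = coef v x * coef w y by rewrite mulf_neq0.
rewrite {1}xE {1}yE mulr_suml coef_sum (bigD1_seq v) ?(mem_support xE) //=.
rewrite mulr_sumr coef_sum (bigD1_seq w) ?(mem_support yE) //=.
have cM v' w' : coef (v ++ w) (coef v' x *: p v' * (coef w' y *: p w')) =
    if (v' == v) && (w' == w) then coef v x * coef w y else 0.
  rewrite -scalerAl -scalerAr -wgen_cat !coefZ coef_gen.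
  case: ifP => [/andP[/eqP-> /eqP->]|vw]; first by rewrite eqxx mulr1.
  have [->|cv'] := eqVneq (coef v' x) 0; first by rewrite mul0r.
  have [->|cw'] := eqVneq (coef w' y) 0; first by rewrite mul0r mulr0.
  have [[vE wE]|lvw] := le _ _ cv' cw'; first by rewrite vE wE !eqxx in vw.
  have [E|] := eqVneq; last by rewrite !mulr0.
  by rewrite E lt_irr in lvw.
rewrite cM !eqxx big1 ?addr0 => [|w' ww']; last by rewrite cM (negPf ww') andbF.
rewrite big1 ?addr0 // => v' vv'; rewrite mulr_sumr coef_sum big1 // => w' _.
by rewrite cM (negPf vv').
Qed.

Lemma leadD x y v w : lead x v -> lead y w -> lt v w -> lead (x + y) w.
Proof.
move=> [cv vP] [cw wP] vw; have xw : coef w x = 0.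
  apply/eqP/negPn/negP => /vP[wv|wv]; first by rewrite wv lt_irr in vw.
  by have := lt_irr v; rewrite (lt_trans vw wv).
split=> [|z]; first by rewrite coefD xw add0r.
have [xz|/vP zv _] := eqVneq (coef z x) 0; last first.
  by right; case: zv => [->|zv] //; apply: lt_trans zv vw.
by rewrite coefD xz add0r => /wP.
Qed.

(** Incomparable words [l v] force the leading words of the products [e v * f v] to be distinct, so
    these cannot cancel in the sum. *)
Lemma lead_combination (s : seq (seq 'I_d)) (e f : seq 'I_d -> A) (l : seq 'I_d -> seq 'I_d) :
  uniq s -> {in s, forall v, wpoly (e v)} -> {in s, forall v, wpoly (f v)} ->
  {in s, forall v, lead (e v) (l v)} ->
  {in s &, forall v w, v != w -> incomparable (l v) (l w)} ->
  {in s, forall v, f v = 0} \/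
  exists z, [/\ lead (\sum_(v <- s) e v * f v) z,
    exists v w, [/\ v \in s, lead (f v) w & z = l v ++ w]
    & forall v w, v \in s -> lead (f v) w -> l v ++ w = z \/ lt (l v ++ w) z].
Proof.
elim: s => [|v s IHs] /=; first by left.
move=> /andP[vs us] pe pf le_ inc; rewrite big_cons.
have sub (P : seq 'I_d -> Prop) : {in v :: s, forall w, P w} -> {in s, forall w, P w}.
  by move=> Pvs w ws; apply: Pvs; rewrite inE ws orbT.
have v_in : v \in v :: s by rewrite inE eqxx.
have incs : {in s &, forall v w, v != w -> incomparable (l v) (l w)}.
  by move=> w z ws zs; apply: inc; rewrite inE ?ws ?zs orbT.
have {IHs} IH := IHs us (sub _ pe) (sub _ pf) (sub _ le_) incs.
have [fv0|fv0] := eqVneq (f v) 0.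
  rewrite fv0 mulr0 add0r; case: IH => [f0|[z [lz [v' [w' [v's lw' zE]]] zP]]].
    by left=> w; rewrite inE => /predU1P[->|/f0].
  right; exists z; split=> //; first by exists v', w'; rewrite inE v's orbT.
  move=> w u; rewrite inE => /predU1P[->|]; last exact: zP.
  by rewrite fv0 => -[]; rewrite coef0 eqxx.
have [w0 lw0] := lead_exists (pf v v_in) fv0.
have lv := leadM (pe v v_in) (pf v v_in) (le_ v v_in) lw0.
right; case: IH => [f0|[z [lz [v' [w' [v's lw' zE]]] zP]]].
  exists (l v ++ w0); rewrite big_seq big1 => [|w ws]; last by rewrite f0 ?mulr0.
  rewrite addr0; split=> //; first by exists v, w0; rewrite v_in.
  move=> w u; rewrite inE => /predU1P[->|ws].
    by move=> /(lead_uniq lw0) ->; left.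
  by rewrite f0 // => -[]; rewrite coef0 eqxx.
have ne : l v ++ w0 != z.
  have vv' : v != v' by apply: contraTneq v's => <-.
  by rewrite zE; apply/incomparable_cat/inc; rewrite ?inE ?v's ?orbT.
have v's_in : v' \in v :: s by rewrite inE v's orbT.
case/orP: (lt_total ne) => ltz.
  exists z; split; [exact: leadD lv lz ltz|by exists v', w'|].
  move=> w u; rewrite inE => /predU1P[->|]; last exact: zP.
  by move=> /(lead_uniq lw0) <-; right.
exists (l v ++ w0); split.
- by rewrite addrC; apply: leadD lz lv ltz.
- by exists v, w0.
move=> w u; rewrite inE => /predU1P[->|ws].
  by move=> /(lead_uniq lw0) <-; left.
by move=> /(zP _ _ ws)[->|zu]; right => //; apply: lt_trans zu ltz.
Qed.

(** The empty word is the default when there is no leading word. *)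
Definition ld x := xget [::] [set w | lead x w]%classic.

Lemma ldP x : wpoly x -> x != 0 -> lead x (ld x).
Proof.
move=> px /(lead_exists px)[w xw].
by apply: (@xgetPex _ _ [set w | lead x w]%classic); exists w.
Qed.

Lemma ldE x w : lead x w -> ld x = w.
Proof.
by move=> xw; apply: (lead_uniq _ xw); apply: (@xgetPex _ _ [set w | lead x w]%classic); exists w.
Qed.

Lemma basis_neq0 u u' v : u' * u = 1 -> u * p v != 0.
Proof.
move=> u'u; apply/eqP => upv; have /eqP := oner_neq0 A; apply.
by rewrite -(wstar_genK star_gen v) -[p v]mul1r -u'u -mulrA upv !mulr0.
Qed.

Variables (H : A -> Prop) (Hgrp : subgroup_pred H).
Hypothesis Htr : forall v w c, incomparable v w -> H (transvection a b v c w).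
Variables (T : seq (seq 'I_d)) (TT : tree T) (m k : nat).
(** The measure [mu] makes the reduction terminate; [adm] confines the words to those on which [mu]
    decreases, such as words of bounded length when lowest words are reduced. *)
Variables (mu : seq 'I_d -> nat) (adm : seq 'I_d -> Prop).
Hypothesis mu_lt : forall v w, lt v w -> adm v -> adm w -> (mu v < mu w)%N.
Hypothesis adm_lead : forall u u' v l, ideal_basis m k T u u' -> v \in T ->
  lead (u * p v) l -> adm l.

(** A right multiple of [u * p v] cancels the leading term of [u * p w]; on [u] this is right
    multiplication by a transvection. *)
Lemma lead_reduction_step u u' v w z l : ideal_basis m k T u u' ->
  v \in T -> w \in T -> v != w -> lead (u * p v) l -> lead (u * p w) (l ++ z) ->
  exists h h', [/\ H h, h * h' = 1, h' * h = 1, ideal_basis m k T (u * h) (h' * u')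
    & {in T, forall z, z != w -> u * h * p z = u * p z} /\
      (mu (ld (u * h * p w)%R) < mu (ld (u * p w)%R))%N].
Proof.
move=> bu vT wT vw lv lw.
have inc (x y : seq 'I_d) : x \in T -> y \in T -> x != y -> incomparable x y.
  exact: tree_incomparable TT.
have ivw := inc _ _ vT wT vw; have [uu' u'u pu pu' ku] := bu.
pose c := coef (l ++ z) (u * p w) / coef l (u * p v).
pose h := transvection a b v (- c *: p z) w.
pose h' := transvection a b v (c *: p z) w.
have hh' : h * h' = 1.
  by have := transvectionN (- c *: p z) ivw; rewrite -scaleNr opprK.
have h'h : h' * h = 1.
  by have := transvectionN (c *: p z) ivw; rewrite -scaleNr.
have uh (x : seq 'I_d) : x \in T -> x != w -> u * h * p x = u * p x.
  by move=> xT xw; rewrite -mulrA transvection_gen // inc // eq_sym.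
have uhw : u * h * p w = u * p w - c *: (u * p v * p z).
  by rewrite -mulrA transvection_genE mulrDr scaleNr mulrN mulrN -!scalerAr mulrA.
have puz : wpoly (u * p v * p z) by apply: wpolyM; [exact: pu|exact: wpolyG].
have lvz : lead (u * p v * p z) (l ++ z).
  apply: leadM => //; [exact: pu|exact: wpolyG|split].
    by rewrite coef_gen eqxx oner_neq0.
  by move=> y; rewrite coef_gen; case: (eqVneq z y) => [->|]; [left|rewrite eqxx].
have coef_vz (y : seq 'I_d) : coef y (u * p v * p z) != 0 ->
    exists2 x : seq 'I_d, y = x ++ z & coef x (u * p v) != 0.
  move=> /(coefM_neq0 (pu _ vT) (wpolyG z))[x [x' [-> cx]]].
  by rewrite coef_gen; case: (eqVneq z x') => [<- _|]; [exists x|rewrite eqxx].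
have bu' : ideal_basis m k T (u * h) (h' * u').
  split.
  - by rewrite mulrA -(mulrA u) hh' mulr1.
  - by rewrite mulrA -(mulrA h') u'u mulr1.
  - move=> x xT; have [->|xw] := eqVneq x w; last by rewrite uh //; apply: pu.
    by rewrite uhw; apply: wpolyB; [exact: pu|exact: wpolyZ].
  (* Only the coordinate at [v] changes, by a polynomial multiple of the coordinate at [w]. *)
  - move=> x xT y ym; have [->|xv] := eqVneq x v.
      rewrite mulrA wstar_transvectionE 2!mulrDl; apply: wpolyD; first exact: pu'.
      rewrite -!scalerAl -!mulrA; apply/wpolyZ/wpolyM; first exact: wpolyG.
      by rewrite mulrA; apply: pu'.
    by rewrite mulrA wstar_transvection ?inc //; apply: pu'.
  - move=> x xT y; have [->|xw] := eqVneq x w; last by rewrite uh //; apply: ku.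
    rewrite uhw coefB coefZ.
    have [->|/(ku _ wT)//] := eqVneq (coef y (u * p w)) 0.
    rewrite sub0r oppr_eq0 mulf_eq0 negb_or => /andP[_ /coef_vz[x' -> /(ku _ vT)]].
    by rewrite size_cat => /leq_trans; apply; rewrite leq_addr.
exists h, h'; split=> //; first exact: Htr.
split=> //.
have lw' : lead (u * h * p w) (ld (u * h * p w)%R).
  have [_ h'u pu1 _ _] := bu'; apply: ldP; first exact: pu1.
  exact: basis_neq0 h'u.
rewrite (ldE lw); apply: mu_lt; [|exact: adm_lead bu' wT lw'|exact: adm_lead bu wT lw].
have cl0 : coef (l ++ z) (u * h * p w) = 0.
  rewrite uhw coefB coefZ; have -> : coef (l ++ z) (u * p v * p z) = coef l (u * p v).
    have [s us E] := wpoly_coef (pu _ vT); rewrite {1}E mulr_suml coef_sum.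
    rewrite (bigD1_seq l) ?(mem_support E) //=; last by case: lv.
    rewrite -scalerAl -wgen_cat coefZ coef_gen eqxx mulr1 big1 ?addr0 // => y yl.
    rewrite -scalerAl -wgen_cat coefZ coef_gen.
    have /negPf-> : y ++ z != l ++ z; last by rewrite mulr0.
    apply: contraNneq yl => E'; move/eqP: (E'); rewrite eqseq_cat => [/andP[]//|].
    by apply/eqP; rewrite -(eqn_add2r (size z)) -!size_cat E'.
  by rewrite divfK ?subrr //; case: lv.
have [cn0 _] := lw'.
have : ld (u * h * p w)%R = l ++ z \/ lt (ld (u * h * p w)%R) (l ++ z).
  have [cy|] := eqVneq (coef (ld (u * h * p w)%R) (u * p w)) 0; last by case: lw => _; apply.
  move: cn0; rewrite {2}uhw coefB coefZ cy sub0r oppr_eq0 mulf_eq0 negb_or => /andP[_].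
  by case: lvz => _; apply.
by case=> // E; rewrite E cl0 eqxx in cn0.
Qed.

(** The sum of [mu] over the leading words drops at each reduction, which is possible as long as one
    leading word is a prefix of another. *)
Lemma lead_reduction u u' : ideal_basis m k T u u' ->
  exists h h', [/\ H h, h * h' = 1, h' * h = 1, ideal_basis m k T (u * h) (h' * u')
    & {in T &, forall v w, v != w ->
        incomparable (ld (u * h * p v)%R) (ld (u * h * p w)%R)}].
Proof.
have [N] := ubnP (\sum_(v <- T) mu (ld (u * p v)%R)).
elim: N u u' => // N IHN u u' leN bu.
have [inc|] := pselect {in T &, forall v w, v != w ->
    incomparable (ld (u * p v)%R) (ld (u * p w)%R)}.
  by exists 1, 1; rewrite !mulr1 mul1r; split=> //; case: Hgrp.
have [_ u'u pu _ _] := bu.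
have lP v : v \in T -> lead (u * p v) (ld (u * p v)%R).
  by move=> vT; apply: ldP; [apply: pu|apply: basis_neq0 u'u].
move=> ninc; have [v [w [vT wT vw pf]]] : exists v w, [/\ v \in T, w \in T, v != w &
    prefix (ld (u * p v)%R) (ld (u * p w)%R)].
  apply: contrapT => no; apply: ninc => v w vT wT vw; apply/andP; split.
    by apply/negP => pf; apply: no; exists v, w.
  by apply/negP => pf; apply: no; exists w, v; rewrite eq_sym.
have [z lwE] := prefixP pf; have lw := lP w wT; rewrite lwE in lw.
have [h [h' [Hh hh' h'h bu' [uh lt_w]]]] := lead_reduction_step bu vT wT vw (lP v vT) lw.
have [|g [g' [Hg gg' g'g bug inc]]] := IHN _ _ _ bu'.
  rewrite ltnS in leN; apply: leq_trans leN.
  have uT : uniq T by case: (tree_uniq TT).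
  rewrite !(bigD1_seq w) //= -addSn leq_add //.
  by rewrite big_seq_cond [leqRHS]big_seq_cond leq_sum // => x /andP[xT xw]; rewrite uh.
exists (h * g), (g' * h'); rewrite !mulrA in bug inc *; split=> //.
- by case: Hgrp => _ + _; apply.
- by rewrite -(mulrA h) gg' mulr1.
- by rewrite -(mulrA g') h'h mulr1.
Qed.

End Lead.

(** * Highest and lowest words *)

Definition lt_num v w := (num v < num w)%N.
(** For this reversed order the leading word of an element is its lowest one. *)
Definition gt_num v w := (num w < num v)%N.

Lemma num_total v w : v != w -> (num v < num w)%N || (num w < num v)%N.
Proof. by rewrite -neq_ltn; apply: contra_neq => /num_inj. Qed.

Lemma lt_num_irr : irreflexive lt_num. Proof. by move=> v; apply: ltnn. Qed.
Lemma gt_num_irr : irreflexive gt_num. Proof. by move=> v; apply: ltnn. Qed.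
Lemma lt_num_trans : transitive lt_num. Proof. by move=> w v z; apply: ltn_trans. Qed.
Lemma gt_num_trans : transitive gt_num.
Proof. by move=> w v z vw wz; apply: ltn_trans wz vw. Qed.
Lemma gt_num_total v w : v != w -> gt_num v w || gt_num w v.
Proof. by rewrite orbC; apply: num_total. Qed.

Lemma gt_num_catl z v w : gt_num v w -> gt_num (z ++ v) (z ++ w).
Proof. exact: ltn_num_catl. Qed.
Lemma gt_num_catr z v w : gt_num v w -> gt_num (v ++ z) (w ++ z).
Proof. exact: ltn_num_catr. Qed.
Lemma lt_num_catl z v w : lt_num v w -> lt_num (z ++ v) (z ++ w).
Proof. exact: ltn_num_catl. Qed.
Lemma lt_num_catr z v w : lt_num v w -> lt_num (v ++ z) (w ++ z).
Proof. exact: ltn_num_catr. Qed.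

Lemma gt_num_measure m v w : gt_num v w -> (size w <= m)%N ->
  (2 * d ^ m - num v < 2 * d ^ m - num w)%N.
Proof.
rewrite /gt_num => vw wm; have /andP[_ wn] := num_bounds w.
have : (d ^ size w <= d ^ m)%N by rewrite leq_exp2l.
move: (d ^ size w)%N (d ^ m)%N wn => x y wn xy; lia.
Qed.

Lemma star_wpoly i x : wpoly x -> coef [::] x = 0 -> wpoly (b i * x).
Proof.
move=> /wpoly_coef[s _ xE] x0; rewrite xE mulr_sumr; apply: wpoly_sum => -[|j w].
  by rewrite x0 scale0r mulr0; apply: wpoly0.
rewrite -scalerAr wgen_cons mulrA star_gen; apply: wpolyZ.
by case: eqVneq => _; rewrite ?mul1r ?mul0r; [apply: wpolyG|apply: wpoly0].
Qed.

(** No word of [x] is a proper prefix of [v], so [q v] either strips [v] from it or kills it. *)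
Lemma wpoly_divl v x : wpoly x -> (forall w, coef w x != 0 -> (size v <= size w)%N) ->
  wpoly (q v * x).
Proof.
move=> /[dup] px /wpoly_coef[s us xE] vx; rewrite xE mulr_sumr.
apply: wpoly_sum => w; rewrite -scalerAr.
have [->|/vx vw] := eqVneq (coef w x) 0; first by rewrite scale0r; apply: wpoly0.
apply: wpolyZ; have [/prefixP[z ->]|vNw] := boolP (prefix v w).
  by rewrite wgen_cat mulrA wstar_genK // mul1r; apply: wpolyG.
rewrite wstar_gen_incomparable //; first exact: wpoly0.
rewrite /incomparable vNw; apply: contra vNw => wv.
suff -> : w = v by apply: prefix_refl.
have [z vE] := prefixP wv; move: vw; rewrite vE size_cat -{2}[size w]addn0 leq_add2l leqn0.
by move=> /nilP->; rewrite cats0.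
Qed.

(** * Reduction of a unit to the identity *)

Section Phases.
Variables (H : A -> Prop) (Hgrp : subgroup_pred H).
Hypothesis Htr : forall v w c, incomparable v w -> H (transvection a b v c w).
Hypothesis Hdil : forall v c, v != [::] -> c != 0 -> H (dilation a b v c).
Hypothesis Hpair : forall s t, tree s -> tree t -> size s = size t -> H (pairing a b s t).

(** The product [q v * u' * (u * p v)] is 1. If all words of [u * p v] were longer than [m], it
    would be a sum of polynomials times nonempty words and have no constant term. *)
Lemma low_term_size m T u u' v l : ideal_basis m 0 T u u' -> v \in T ->
  lead gt_num (u * p v) l -> (size l <= m)%N.
Proof.
move=> [uu' u'u pu pu' _] vT [_ lP]; rewrite leqNgt; apply/negP => ml.
have [s us E] := wpoly_coef (pu v vT).
have : coef [::] (q v * u' * (u * p v)) = 1.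
  by rewrite mulrA -(mulrA (q v)) u'u mulr1 wstar_genK // -(wgen0 a) coef_gen eqxx.
rewrite E mulr_sumr coef_sum big1 => [/eqP|z _]; first by rewrite eq_sym oner_eq0.
rewrite -scalerAr coefZ; have [->|/lP zl] := eqVneq (coef z (u * p v)) 0.
  by rewrite mul0r.
have mz : (m < size z)%N.
  by apply: leq_trans ml _; case: zl => [->|/ltnW/leq_num_size].
rewrite -[z](cat_take_drop m) wgen_cat mulrA.
have [->|cz] := eqVneq (coef [::] (q v * u' * p (take m z) * p (drop m z))) 0.
  by rewrite mulr0.
have pz : wpoly (q v * u' * p (take m z)) by apply: pu'; rewrite ?size_takel // ltnW.
have [x [y [xy _]]] := coefM_neq0 pz (wpolyG _) cz.
rewrite coef_gen; have [dE|] := eqVneq (drop m z) y; last by rewrite eqxx.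
have /(congr1 size) := xy; rewrite -dE size_cat size_drop /=; lia.
Qed.

(** When [p w] is expanded on the basis, the lowest words of the summands do not cancel; a constant
    term at [v] would leave a word shorter than [w]. *)
Lemma coef_nil_coordinate m k T u u' v w : tree T -> ideal_basis m k T u u' ->
  {in T &, forall v w, v != w ->
     incomparable (ld gt_num (u * p v)) (ld gt_num (u * p w))} ->
  v \in T -> size w = m -> (size (ld gt_num (u * p v)) < m)%N ->
  coef [::] (q v * u' * p w) = 0.
Proof.
move=> TT [uu' u'u pu pu' _] inc vT wm lv.
have lP z : z \in T -> lead gt_num (u * p z) (ld gt_num (u * p z)).
  move=> zT; apply: (ldP gt_num_trans gt_num_total); first exact: pu.
  exact: basis_neq0 u'u.
have wE : \sum_(z <- T) u * p z * (q z * u' * p w) = p w.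
  rewrite -[RHS]mul1r -uu' -[in RHS](mulr1 u) -(tree_sum gen_star TT).
  by rewrite mulr_sumr !mulr_suml; apply: eq_bigr => z _; rewrite !mulrA.
have lw : lead gt_num (p w) w.
  split=> [|z]; first by rewrite coef_gen eqxx oner_neq0.
  by rewrite coef_gen; case: (eqVneq w z) => [->|_]; [left|rewrite eqxx].
have [f0|[z [lz _ zP]]] := lead_combination gt_num_irr gt_num_trans gt_num_total
  gt_num_catl gt_num_catr (tree_uniq TT).1 pu (fun v vT => pu' v vT w wm) lP inc.
  by rewrite f0 // coef0.
rewrite wE in lz; have {lz} zw := lead_uniq gt_num_irr gt_num_trans lz lw.
apply/eqP/negPn/negP => cf.
have lf : lead gt_num (q v * u' * p w) [::].
  split=> // y _; have [->|y0] := eqVneq y [::]; [by left|right].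
  rewrite /gt_num; case: y y0 => // i y _ /=; have := num_gt0 y; nia.
case: (zP v [::] vT lf); rewrite cats0 zw; last by move=> /ltnW/leq_num_size; rewrite wm leqNgt lv.
move=> E.
by move: lv; rewrite E wm ltnn.
Qed.

(** A leaf whose lowest word is too short is replaced by its children; the unit itself does not
    change. *)
Lemma low_expansion m T u u' : tree T -> ideal_basis m 0 T u u' ->
  {in T &, forall v w, v != w ->
     incomparable (ld gt_num (u * p v)) (ld gt_num (u * p w))} ->
  exists2 T', tree T' & ideal_basis m m T' u u'.
Proof.
(* The base [n.+3] is [d + 1]: a leaf is replaced by [d] leaves, each of a weight [d + 1] times
   smaller. *)
have [N] := ubnP (\sum_(v <- T) n.+3 ^ (m - size (ld gt_num (u * p v)))).
elim: N T => // N IHN T leN TT bu inc; have [uu' u'u pu pu' _] := bu.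
have lP z : z \in T -> lead gt_num (u * p z) (ld gt_num (u * p z)).
  move=> zT; apply: (ldP gt_num_trans gt_num_total); first exact: pu.
  exact: basis_neq0 u'u.
have [[v vT lv]|no] := pselect
  (exists2 v, v \in T & (size (ld gt_num (u * p v)) < m)%N); last first.
  exists T => //; split=> // v vT z cz; rewrite leqNgt; apply/negP => zm; apply: no.
  exists v => //; apply: leq_ltn_trans zm.
  by have [_ /(_ z cz)] := lP v vT; case=> [->//|/ltnW/leq_num_size].
set l := ld gt_num (u * p v) in lv *.
have perm_T := perm_to_rem vT; set s := rem v T in perm_T.
have sT z : z \in s -> z \in T by apply: mem_rem.
have vs : v \notin s by have [uT _] := tree_uniq TT; rewrite mem_rem_uniq // inE eqxx.
pose T' := [seq rcons v i | i <- enum 'I_d] ++ s.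
have TT' : tree T' by apply/tree_expand/(tree_perm perm_T).
have upr i : u * p (rcons v i) = u * p v * p [:: i] by rewrite -cats1 wgen_cat mulrA.
have ldr i : ld gt_num (u * p (rcons v i)) = l ++ [:: i].
  apply: (ldE gt_num_irr gt_num_trans); rewrite upr.
  apply: (leadM gt_num_irr gt_num_trans gt_num_catl gt_num_catr).
  - exact: pu.
  - exact: wpolyG.
  - exact: lP.
  split=> [|y]; first by rewrite coef_gen eqxx oner_neq0.
  by rewrite coef_gen; case: (eqVneq [:: i] y) => [->|_]; [left|rewrite eqxx].
apply: (IHN T') => //.
- rewrite ltnS in leN; apply: leq_trans leN.
  rewrite (perm_big _ perm_T) /= big_cons -/l big_cat big_map big_enum /=.
  under eq_bigr => i _ do rewrite ldr size_cat addn1.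
  rewrite sum_nat_const card_ord -(subnSK lv) expnS -addSn leq_add2r.
  by rewrite [leqRHS]mulSn -add1n leq_add2r expn_gt0.
- split=> // z; rewrite mem_cat => /orP[/mapP[i _ ->]|/sT zT] //.
  + by rewrite upr; apply: wpolyM; [apply: pu|apply: wpolyG].
  + exact: pu.
  (* A new coordinate is [b i] times the old one, and remains a polynomial because the old one has
     no constant term. *)
  + move=> w wm; rewrite -cats1 wstar_cat wstar1 -!mulrA; apply: star_wpoly; rewrite mulrA.
      exact: pu'.
    exact: (coef_nil_coordinate TT bu).
  + exact: pu'.
move=> x y; rewrite !mem_cat => /orP[/mapP[i _ ->]|xs] /orP[/mapP[j _ ->]|ys] xy.
- rewrite !ldr; apply: incomparable_size; first by rewrite !size_cat.
  by rewrite !cats1; apply: contra_neq xy => E; rewrite (rcons_injr l E).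
- rewrite ldr; apply/incomparable_catl/inc => //; first exact: sT.
  by apply/eqP => E; case/negP: vs; rewrite E.
- rewrite ldr incomparableC; apply/incomparable_catl/inc => //; first exact: sT.
  by apply/eqP => E; case/negP: vs; rewrite E.
by apply: inc; rewrite ?sT.
Qed.

Let HM x y : H x -> H y -> H (x * y). Proof. by case: Hgrp => _ + _; apply. Qed.

Lemma subgroup_inv x y : H x -> x * y = 1 -> H y.
Proof.
case: Hgrp => _ _ + Hx xy => /(_ x Hx)[z [_ zx Hz]].
by have -> : y = z by rewrite -[y]mul1r -zx -mulrA xy mulr1.
Qed.

(** All factors share the last word [w], and [q w] kills every [p v], so products add up the
    columns. *)
Lemma transvection_column (s : seq (seq 'I_d)) w (c : seq 'I_d -> A) :
  {in s, forall v, incomparable v w} ->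
  H (1 + (\sum_(v <- s) p v * c v) * q w).
Proof.
elim: s => [_|v s IHs inc]; first by rewrite big_nil mul0r addr0; case: Hgrp.
have incs : {in s, forall v, incomparable v w}.
  by move=> z zs; apply: inc; rewrite inE zs orbT.
have vw : incomparable v w by apply: inc; rewrite inE eqxx.
have := HM (Htr (c v) vw) (IHs incs); rewrite /transvection mulrDr mulr1 mulrDl mul1r.
have -> : p v * c v * q w * ((\sum_(v <- s) p v * c v) * q w) = 0.
  rewrite -!mulrA [q w * _]mulrA mulr_sumr big_seq big1 ?mul0r ?mulr0 // => z zs.
  by rewrite mulrA wstar_gen_incomparable ?mul0r // incomparableC incs.
by rewrite addr0 big_cons mulrDl addrA.
Qed.

Lemma eq1_on_words m x : (forall w, size w = m -> x * p w = p w) -> x = 1.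
Proof.
move=> xp; rewrite -(tree_sum gen_star (words_tree n m)) -[x]mulr1.
rewrite -{1}(tree_sum gen_star (words_tree n m)) mulr_sumr !big_seq.
by apply: eq_bigr => w; rewrite mem_words mulrA => /eqP/xp->.
Qed.

(** Column reduction over the words of length [m], in increasing order of [num], exhibits [y] as the
    inverse of an element of [H]. *)
Lemma triangular_mem m y y' : (0 < m)%N -> y' * y = 1 ->
  (forall w, size w = m -> [/\ wpoly (y * p w), coef w (y * p w) != 0
     & forall z, coef z (y * p w) != 0 -> size z = m /\ (num z <= num w)%N]) ->
  H y.
Proof.
move=> m_gt0 y'y yP.
(* The bound [2 * d ^ m], above the numbers of all words of length [m], is then generalised to [N]:
   columns below [N] are reduced, and [h] fixes the others. *)
suff [h Hh hP] : exists2 h, H h & forall w, size w = m ->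
    ((num w < 2 * d ^ m)%N -> y * h * p w = p w) /\ ((2 * d ^ m <= num w)%N -> h * p w = p w).
  have yh : y * h = 1.
    apply: (@eq1_on_words m) => w wm; apply: (hP w wm).1.
    by have /andP[_] := num_bounds w; rewrite wm.
  case: Hgrp => _ _ /(_ h Hh)[g [hg gh Hg]].
  by have -> : y = g by rewrite -[y]mulr1 -hg mulrA yh mul1r.
move: (2 * d ^ m)%N => N; elim: N => [|N [h Hh hP]].
  by exists 1; [case: Hgrp|move=> w wm; split=> // _; rewrite mul1r].
have [[w0 w0m w0N]|no] := pselect (exists2 w0 : seq 'I_d, size w0 = m & num w0 = N); last first.
  exists h => // w wm; split=> [|Nw]; last exact: (hP w wm).2 (ltnW Nw).
  rewrite ltnS leq_eqVlt => /orP[/eqP wN|/(hP w wm).1//].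
  by case: no; exists w.
have [pe ce eP] := yP w0 w0m; set e := y * p w0 in pe ce eP.
have [s us eE] := wpoly_coef pe; set c := coef w0 e in ce.
pose s' := [seq z <- s | (z != w0) && (coef z e != 0)].
pose x := \sum_(z <- s') p z * (coef z e)%:A.
have eE' : e = c *: p w0 + x.
  rewrite {1}eE (bigD1_seq w0) ?(mem_support eE) //=; congr (_ + _).
  rewrite /x big_filter [LHS](bigID (fun z => coef z e != 0)) /= [X in _ + X]big1.
    by rewrite addr0; apply: eq_bigr => z _; rewrite -scalerAr mulr1.
  by move=> z /andP[_ /negPn/eqP->]; rewrite scale0r.
have s'P z : z \in s' -> [/\ size z = m, z != w0 & (num z < N)%N].
  rewrite mem_filter => /andP[/andP[zw0 cz] _]; have [zm] := eP z cz.
  rewrite leq_eqVlt w0N => /orP[/eqP E|//]; case/eqP: zw0.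
  by apply: num_inj; rewrite E.
have inc z : size z = m -> z != w0 -> incomparable z w0.
  by move=> zm; apply: incomparable_size; rewrite zm w0m.
have w00 : w0 != [::] by rewrite -size_eq0 w0m -lt0n.
(* The factor [h2] normalises the diagonal entry, and [h1] removes the rest [x] of the column, which
   [y * h] fixes because its words have smaller numbers. *)
pose h1 := 1 - x * q w0; pose h2 := dilation a b w0 c^-1.
have Hh1 : H h1.
  rewrite /h1 -mulNr /x -sumrN; under eq_bigr => z _ do rewrite -mulrN.
  by apply: transvection_column => z /s'P[zm zw0 _]; apply: inc.
have Hh2 : H h2 by apply: Hdil; rewrite ?invr_eq0.
have h12 w : size w = m -> w != w0 -> h1 * h2 * p w = p w.
  move=> wm ww0; have iw := inc w wm ww0; have iw' : incomparable w0 w by rewrite incomparableC.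
  have h2w : h2 * p w = p w.
    rewrite /h2 /dilation mulrDl mul1r -scalerAl -mulrA wstar_gen_incomparable //.
    by rewrite mulr0 scaler0 addr0.
  by rewrite -mulrA h2w /h1 mulrBl mul1r -mulrA wstar_gen_incomparable // mulr0 subr0.
have h12w0 : h1 * h2 * p w0 = c^-1 *: (p w0 - x).
  have h2w : h2 * p w0 = c^-1 *: p w0.
    rewrite /h2 /dilation mulrDl mul1r -scalerAl -mulrA wstar_genK // mulr1.
    by rewrite -[X in X + _]scale1r -scalerDl addrCA subrr addr0.
  rewrite -mulrA h2w -scalerAr; congr (_ *: _).
  by rewrite /h1 mulrBl mul1r -mulrA wstar_genK // mulr1.
exists (h * (h1 * h2)); first by apply: HM => //; apply: HM.
move=> w wm; split=> [|Nw].
  rewrite ltnS leq_eqVlt => /orP[/eqP wN|wN]; last first.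
    rewrite -!mulrA mulrA (mulrA h1) h12 //; first exact: (hP w wm).1.
    by apply: contraTneq wN => ->; rewrite w0N ltnn.
  have -> : w = w0 by apply: num_inj; rewrite wN.
  rewrite mulrA -mulrA h12w0 -scalerAr mulrBr -(mulrA y) (hP w0 w0m).2 ?w0N // -/e.
  have -> : y * h * x = x.
    rewrite /x mulr_sumr [LHS]big_seq [RHS]big_seq; apply: eq_bigr => z /s'P[zm _ zN].
    by rewrite mulrA (hP z zm).1.
  by rewrite eE' addrK scalerA mulVf // scale1r.
rewrite -mulrA h12 ?(hP w wm).2 ?(ltnW Nw) //.
by apply: contraTneq Nw => ->; rewrite w0N ltnn.
Qed.

Lemma pairing_map T (f : seq 'I_d -> seq 'I_d) :
  pairing a b T (map f T) = \sum_(v <- T) p v * q (f v).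
Proof.
by rewrite /pairing; elim: T => [|v T IHT] /=; rewrite ?big_nil // !big_cons IHT.
Qed.

(** Each word of length [m] is a combination of the basis, so it extends some highest word, and
    lengths force equality. Conversely, a longer highest word would have another one as a prefix. *)
Lemma lt_lead_words m T u u' : tree T -> ideal_basis m m T u u' ->
  {in T &, forall v w, v != w ->
     incomparable (ld lt_num (u * p v)) (ld lt_num (u * p w))} ->
  perm_eq (map (fun v => ld lt_num (u * p v)) T) (words n m).
Proof.
move=> TT [uu' u'u pu pu' ku] inc; set L := fun v => ld lt_num (u * p v).
have lP z : z \in T -> lead lt_num (u * p z) (L z).
  move=> zT; apply: (ldP lt_num_trans num_total); first exact: pu.
  exact: basis_neq0 u'u.
have Lm v : v \in T -> (m <= size (L v))%N.
  by move=> vT; apply: (ku v vT); case: (lP v vT).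
have L_onto w : size w = m -> exists2 v, v \in T & L v = w.
  move=> wm; have wE : \sum_(z <- T) u * p z * (q z * u' * p w) = p w.
    rewrite -[RHS]mul1r -uu' -[in RHS](mulr1 u) -(tree_sum gen_star TT).
    by rewrite mulr_sumr !mulr_suml; apply: eq_bigr => z _; rewrite !mulrA.
  have [f0|[z [lz [v [x [vT _ zE]]] _]]] := lead_combination lt_num_irr lt_num_trans num_total
    lt_num_catl lt_num_catr (tree_uniq TT).1 pu (fun v vT => pu' v vT w wm) lP inc.
    have /eqP := basis_neq0 w (mulr1 1); rewrite mul1r -wE big_seq big1 // => z zT.
    by rewrite f0 ?mulr0.
  rewrite wE in lz; have lw : lead lt_num (p w) w.
    split=> [|y]; first by rewrite coef_gen eqxx oner_neq0.
    by rewrite coef_gen; case: (eqVneq w y) => [->|_]; [left|rewrite eqxx].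
  have {lz} zw := lead_uniq lt_num_irr lt_num_trans lz lw.
  exists v => //; have := Lm v vT; move: wm; rewrite -zw zE size_cat => <-.
  by rewrite -{2}[size (L v)]addn0 leq_add2l leqn0 => /nilP->; rewrite cats0.
have L_inj : {in T &, injective L}.
  move=> v w vT wT E; apply/eqP/negPn/negP => vw.
  by have := inc v w vT wT vw; rewrite -/(L v) -/(L w) E /incomparable prefix_refl.
apply: uniq_perm; first by rewrite map_inj_in_uniq //; case: (tree_uniq TT).
  by case: (tree_uniq (words_tree n m)).
move=> w; rewrite mem_words; apply/mapP/eqP => [[v vT ->]|/L_onto[v vT <-]]; last by exists v.
have [|v' v'T Lv'] := L_onto (take m (L v)); first by rewrite size_takel ?Lm.
have [vv'|vv'] := eqVneq v' v; last first.
  have := inc v' v v'T vT vv'; rewrite -/(L v) -/(L v') Lv' /incomparable.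
  by rewrite prefix_take.
by rewrite -vv' Lv' size_takel ?Lm.
Qed.

Lemma unit_mem u u' : u * u' = 1 -> u' * u = 1 ->
  (exists N, forall w, (N <= size w)%N -> wpoly (u * p w)) ->
  (exists N, forall w, (N <= size w)%N -> wpoly (u' * p w)) -> H u.
Proof.
(* In a word of length [m], the first [n1.+1] letters make [u'] polynomial, and the other [n0] let
   [q v] divide when [size v = n0]; the successor keeps [m] positive. *)
move=> uu' u'u [n0 pu] [n1 pu']; pose m := (n1 + n0).+1.
have TT0 := words_tree n n0.
have b0 : ideal_basis m 0 (words n n0) u u'.
  split=> // v; rewrite mem_words => /eqP vm; first by apply: pu; rewrite vm.
  move=> w wm; have pw : wpoly (u' * p (take n1.+1 w)).
    by apply: pu'; rewrite size_takel // wm ltnS leq_addr.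
  have -> : q v * u' * p w = q v * (u' * p (take n1.+1 w) * p (drop n1.+1 w)).
    by rewrite -!mulrA -wgen_cat cat_take_drop.
  apply: wpoly_divl => [|z]; first by apply: wpolyM => //; apply: wpolyG.
  move=> /(coefM_neq0 pw (wpolyG _))[x [y [-> _]]].
  rewrite coef_gen; case: (eqVneq (drop n1.+1 w) y) => [<- _|]; last by rewrite eqxx.
  by rewrite size_cat size_drop wm vm /m -addSn addKn leq_addl.
(* First the lowest words: their numbers grow under reduction, but their lengths stay at most
   [m]. *)
have [h [h' [Hh hh' h'h b1 inc1]]] := lead_reduction gt_num_irr gt_num_trans gt_num_total
  gt_num_catl gt_num_catr Hgrp Htr TT0
  (mu := fun l => (2 * d ^ m - num l)%N) (adm := fun l => (size l <= m)%N)
  (fun v w vw vm wm => gt_num_measure vw wm) (fun u u' v l => @low_term_size m _ u u' v l) b0.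
have [T TT b2] := low_expansion TT0 b1 inc1.
(* Then the highest words, whose numbers decrease. *)
have [g [g' [Hg gg' g'g b3 inc3]]] := lead_reduction lt_num_irr lt_num_trans num_total
  lt_num_catl lt_num_catr Hgrp Htr TT
  (mu := @num n) (adm := fun=> True) (fun v w vw _ _ => vw) (fun _ _ _ _ _ _ _ => I) b2.
have permL := lt_lead_words TT b3 inc3; set L := fun v => _ in permL.
set u2 := u * h * g in b3 inc3 L permL; have [u2u u2'u pu2 _ ku2] := b3.
set u2' := g' * (h' * u') in u2u u2'u.
pose s := map L T.
have Ts : tree s by apply: tree_perm (words_tree n m); rewrite perm_sym.
have sz : size T = size s by rewrite size_map.
have y'y : pairing a b s T * u2' * (u2 * pairing a b T s) = 1.
  rewrite mulrA -(mulrA _ u2') u2'u mulr1 (pairing_trans star_gen TT) //.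
  by rewrite (pairing_id gen_star Ts).
(* The pairing relabels the leaves by their highest words, after which the unit is triangular on the
   words of length [m]. *)
have yL v : v \in T -> u2 * pairing a b T s * p (L v) = u2 * p v.
  move=> vT; rewrite -mulrA /s pairing_map; congr (_ * _).
  have uT : uniq T by case: (tree_uniq TT).
  rewrite mulr_suml (bigD1_seq v) //= -mulrA wstar_genK // mulr1 big_seq_cond big1 ?addr0 //.
  by move=> w /andP[wT wv]; rewrite -mulrA wstar_gen_incomparable ?mulr0 //; apply: inc3.
have Hy : H (u2 * pairing a b T s).
  apply: (@triangular_mem m _ _ _ y'y) => // w wm.
  have : w \in s by rewrite (perm_mem permL) mem_words wm.
  case/mapP => v vT wE; rewrite wE yL //.
  have [cL lL] : lead lt_num (u2 * p v) (L v).
    by apply: (ldP lt_num_trans num_total); [apply: pu2|apply: basis_neq0 u2'u].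
  split=> // [|z cz]; first exact: pu2.
  have lez : (num z <= num (L v))%N by case: (lL z cz) => [->|/ltnW].
  split=> //; apply/eqP; rewrite eqn_leq (ku2 v vT z cz) andbT.
  by have := leq_num_size lez; rewrite -wE wm.
have Hu2 : H u2.
  have := HM Hy (Hpair Ts TT (esym sz)).
  by rewrite -mulrA (pairing_trans star_gen Ts) // (pairing_id gen_star TT) mulr1.
have -> : u = u2 * g' * h' by rewrite /u2 -(mulrA (u * h)) gg' mulr1 -mulrA hh' mulr1.
by apply: HM; [apply: HM => //; apply: subgroup_inv Hg gg'|apply: subgroup_inv Hh hh'].
Qed.

End Phases.

End Polynomials.

(** * The unit group of the Leavitt algebra *)

Section LeavittUnits.
Context (K : fieldType) (n : nat).
Local Notation d := n.+2.
Local Notation L := (leavitt K d).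
Local Notation a := (@leavitt_gen K d).
Local Notation b := (@leavitt_star K d).
Local Notation p := (@wgen K n L a).

Let star_gen i j : b i * a j = (i == j)%:R := leavitt_star_gen K i j.
Let gen_star : \sum_i a i * b i = 1 := leavitt_gen_star K d.

(** The action of [x] on the indicator of 1, read at [num w]. *)
Definition leavitt_coef (w : seq 'I_d) (x : L) : K :=
  lrep (repr x) (fun k => (k == 1)%:R) (num w).

Lemma leavitt_coefD w (x y : L) :
  leavitt_coef w (x + y) = leavitt_coef w x + leavitt_coef w y.
Proof. exact: (lrep_cong (leavitt_repr _)). Qed.

Lemma leavitt_coefZ w c (x : L) : leavitt_coef w (c *: x) = c * leavitt_coef w x.
Proof.
rewrite /leavitt_coef (lrep_cong (leavitt_repr _)) /=.
by rewrite (lrep_cong (leavitt_repr _)).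
Qed.

Lemma leavitt_coef_gen w v : leavitt_coef w (p v) = (v == w)%:R.
Proof.
suff rep m : lrep (repr (p v)) (fun k => (k == 1)%:R) m = (m == num v)%:R :> K.
  by rewrite /leavitt_coef rep (inj_eq (@num_inj n)) eq_sym.
elim: v m => [|i v IHv] m.
  by rewrite wgen0 (lrep_cong (leavitt_repr _)) /= mul1r.
rewrite wgen_cons (lrep_cong (leavitt_repr _)) /= (lrep_cong (leavitt_repr _)) /= IHv.
have [mi|mi] := eqVneq (m %% d)%N i.
  by rewrite [in RHS](divn_eq m d) mi mulnC eqn_add2r eqn_pmul2l.
case: eqP => // mE; case/eqP: mi.
by rewrite mE mulnC modnMDl modn_small.
Qed.

(** Each star is used up by one letter of a sufficiently long word. *)
Lemma leavitt_mul_wpoly (x : L) :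
  exists N, forall w, (N <= size w)%N -> wpoly a (x * p w).
Proof.
elim/leavitt_ind: x => t.
elim: t => [c|i|i|t [N tN] u [M uM]|t [N tN]|t [N tN] u [M uM]].
- by exists 0%N => w _; rewrite -[_ * _]/(c *: p w); apply/wpolyZ/wpolyG.
- by exists 0%N => w _; rewrite -[_ * _]/(a i * p w) -wgen_cons; apply: wpolyG.
- exists 1%N => -[|j w] // _; rewrite -[_ * _]/(b i * p (j :: w)) wgen_cons mulrA star_gen.
  by case: eqVneq => _; rewrite ?mul1r ?mul0r; [apply: wpolyG|apply: wpoly0].
- exists (maxn N M) => w; rewrite geq_max => /andP[Nw Mw].
  by rewrite pi_leavitt_add mulrDl; apply: wpolyD; [apply: tN|apply: uM].
- by exists N => w Nw; rewrite pi_leavitt_opp mulNr -scaleN1r; apply/wpolyZ/tN.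
(* The first [M] letters turn the factor [u] into a polynomial, and at least [N] letters are left
   for [t]. *)
exists (M + N)%N => w MNw; rewrite pi_leavitt_mul -[w](cat_take_drop M) wgen_cat.
have [|s E] := uM (take M w); first by rewrite size_takel //; lia.
rewrite -mulrA [X in _ * X]mulrA E mulr_suml mulr_sumr; apply: wpoly_sum => z.
rewrite -scalerAl -scalerAr -wgen_cat; apply/wpolyZ/tN.
by rewrite size_cat size_drop; lia.
Qed.

Lemma dilationM w (c e : K) :
  dilation a b w c * dilation a b w e = dilation a b w (c * e) :> L.
Proof.
rewrite /dilation mulrDl mul1r mulrDr mulr1 -scalerAl -scalerAr scalerA.
have -> : p w * wstar b w * (p w * wstar b w) = p w * wstar b w.
  by rewrite -mulrA (mulrA (wstar b w)) wstar_genK // mul1r.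
by rewrite -addrA -!scalerDl; congr (1 + _ *: _); ring.
Qed.

Lemma units_seq (R : pzRingType) (s : seq R) :
  (forall x, x \in s -> exists y, x * y = 1 /\ y * x = 1) ->
  exists t : seq (unit_group R), forall x, x \in s -> exists2 u, u \in t & unit_val u = x.
Proof.
elim: s => [|x s IHs] xs; first by exists [::].
have [|t ts] := IHs; first by move=> y ys; apply: xs; rewrite inE ys orbT.
have [u ux] := (unit_valP x).2 (xs x (mem_head x s)).
exists (u :: t) => y; rewrite inE => /predU1P[->|/ts[v vt <-]].
  by exists u; rewrite ?inE ?eqxx.
by exists v; rewrite // inE vt orbT.
Qed.

Lemma generated_subgroup (R : pzRingType) (s : seq (unit_group R)) :
  subgroup_pred (fun x => exists2 u, generated_by s u & unit_val u = x).
Proof.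
split=> [|x y [u us <-] [v vs <-]|x [u us <-]].
- by exists (unit_one R); [apply: generated_one|].
- by exists (u * v)%g; [apply: generated_mul|].
exists (unit_val u^-1%g); have /andP[/eqP uv /eqP vu] := valP u; split=> //.
by exists u^-1%g; [apply: generated_inv|].
Qed.

(** Supplies the intermediate word of a commutator; length 2 leaves room for it even when [d] is
    2. *)
Lemma third_word (v w : seq 'I_d) : exists z, [/\ size z = 2%N, z != v & z != w].
Proof.
pose s := [:: [:: 0; 0]; [:: 0; 1]; [:: 1; 0]] : seq (seq 'I_d).
have us : uniq s by [].
have [/hasP[z zs]|/hasPn no] := boolP (has (fun z => z \notin [:: v; w]) s).
  rewrite !inE negb_or => /andP[zv zw]; exists z; split=> //.
  by move: zs; rewrite !inE => /or3P[] /eqP->.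
by have := uniq_leq_size us (fun z zs => negbNE (no z zs)).
Qed.

Lemma unit_group_finite_fg :
  finite_set [set: K]%classic -> finitely_generated (unit_group L).
Proof.
move=> /finite_seqP[ks ksE]; have Kks c : c \in ks.
  by have : [set: K]%classic c by []; rewrite ksE.
pose gens := [seq leavitt_const d c | c <- ks] ++ [seq a i | i <- enum 'I_d]
  ++ [seq b i | i <- enum 'I_d].
pose pairs := [seq vw <- [seq (v, w) | v <- words n 2, w <- words n 2] | vw.1 != vw.2].
pose ts := [seq transvection a b vw.1 c vw.2 | vw <- pairs, c <- gens].
pose ds := [seq dilation a b [:: i] c | i <- enum 'I_d, c <- [seq c <- ks | c != 0]].
have pairsE v w : ((v, w) \in pairs) = [&& size v == 2%N, size w == 2%N & v != w].
  rewrite mem_filter /= -!mem_words andbA [RHS]andbC; congr (_ && _).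
  by apply/allpairsP/andP => [[[x y] [xs ys [-> ->]]]|[vs ws]] //; exists (v, w).
have [|s sP] := @units_seq L (ts ++ ds).
  move=> x; rewrite mem_cat => /orP[] /allpairsP[].
    case=> [[v w] c] /= [+ _ ->]; rewrite pairsE => /and3P[/eqP v2 /eqP w2 vw].
    have ivw : incomparable v w by apply: incomparable_size; rewrite ?v2.
    exists (transvection a b v (- c) w); split; first exact: transvectionN.
    by rewrite -{2}[c]opprK; apply: transvectionN.
  case=> i c /= [_ + ->]; rewrite mem_filter => /andP[c0 _].
  by exists (dilation a b [:: i] c^-1); rewrite !dilationM mulfV // mulVf //
     /dilation subrr scale0r addr0.
pose H (x : L) := exists2 u, generated_by s u & unit_val u = x.
have Hgrp : subgroup_pred H := generated_subgroup s.
have Hmem x : x \in ts ++ ds -> H x.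
  by move=> /sP[u us <-]; exists u => //; apply: generated_mem.
have Hgen v w c : size v = 2%N -> size w = 2%N -> v != w -> c \in gens ->
    H (transvection a b v c w).
  move=> v2 w2 vw cg; apply: Hmem; rewrite mem_cat; apply/orP; left.
  by apply/allpairsP; exists ((v, w), c); rewrite pairsE v2 w2 vw.
have Htr2 v w c : size v = 2%N -> size w = 2%N -> v != w -> H (transvection a b v c w).
  elim/leavitt_ind: c v w => t.
  have inc v w : size v = 2%N -> size w = 2%N -> v != w -> incomparable v w.
    by move=> v2 w2; apply: incomparable_size; rewrite v2.
  have HN v w c : size v = 2%N -> size w = 2%N -> v != w ->
      H (transvection a b v c w) -> H (transvection a b v (- c) w).
    by move=> v2 w2 vw Hc; apply: (subgroup_inv Hgrp Hc); apply/transvectionN/inc.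
  (* Coefficients are built up from ring generators: sums by additivity, products by commutators
     through a third word. *)
  elim: t => [c|i|i|t IHt u IHu|t IHt|t IHt u IHu] v w v2 w2 vw.
  - by apply: Hgen => //; rewrite mem_cat map_f.
  - by apply: Hgen => //; rewrite !mem_cat (map_f a) ?mem_enum ?orbT.
  - by apply: Hgen => //; rewrite !mem_cat (map_f b) ?mem_enum ?orbT.
  - rewrite pi_leavitt_add transvectionD ?inc //.
    by case: Hgrp => _ HM _; apply: HM; [apply: IHt|apply: IHu].
  - by rewrite pi_leavitt_opp; apply: HN => //; apply: IHt.
  have [z [z2 zv zw]] := third_word v w; rewrite eq_sym in zv.
  rewrite pi_leavitt_mul; apply: (transvection_trans star_gen Hgrp (z := z));
    by [apply: inc|apply: IHt|apply: IHu|apply: HN => //; apply: IHt|apply: HN => //; apply: IHu].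
have HD i (c : K) : c != 0 -> H (1 + (c - 1) *: (a i * b i)).
  move=> c0; rewrite -(wgen1 a) -(wstar1 b); apply: Hmem; rewrite mem_cat; apply/orP; right.
  by apply/allpairsP; exists (i, c); rewrite mem_enum mem_filter c0 Kks.
exists s => u; have /andP[/eqP uu' /eqP u'u] := valP u.
suff [v vs vu] : H (val u).1 by rewrite -(unit_val_inj vu).
apply: (unit_mem star_gen gen_star leavitt_coefD leavitt_coefZ leavitt_coef_gen Hgrp
  _ _ _ uu' u'u (leavitt_mul_wpoly _) (leavitt_mul_wpoly _)).
- by move=> v w c vw; apply: (transvection_mem star_gen gen_star Hgrp).
- by move=> v c; apply: (dilation_mem star_gen gen_star Hgrp).
- by move=> v w; apply: (pairing_mem star_gen gen_star Hgrp).
Qed.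

End LeavittUnits.

Local Close Scope ring_scope.

Theorem corollary7p3 (K : fieldType) (d : nat) (hd : 2 <= d) :
  finitely_generated (unit_group (leavitt K d)) <-> finite_set [set: K]%classic.
Proof.
case: d hd => [|[|n]] // _; split; first exact: unit_group_fg_finite.
exact: unit_group_finite_fg.
Qed.
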